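(* There is an algorithm and a universal constant $C>0$ such that, given any positive integer $T$, $x \in \{0,1\}^T$ and $p \in [0,1]^T$, the algorithm runs in time polynomial in $T$ and outputs a number $v$ with $|v - \mathsf{CalDist}(x,p)| \le C\sqrt{T}$.
   Context: For $x \in \{0,1\}^T$, let $\mathcal{C}(x) = \{q \in [0,1]^T : \sum_{t=1}^T (x_t - q_t)\mathbf{1}[q_t = \alpha] = 0 \text{ for all } \alpha \in [0,1]\}$. The calibration distance of predictions $p \in [0,1]^T$ with respect to outcomes $x$ is $\mathsf{CalDist}(x,p) = \min_{q \in \mathcal{C}(x)} \|p - q\|_1$. *)

(* Defs.v *)
From HB Require Import structures.
From mathcomp Require Import all_boot all_order all_algebra.
From mathcomp Require Import boolp classical_sets reals.
Set Implicit Arguments. Unset Strict Implicit. Unset Printing Implicit Defensive.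
Import Order.TTheory GRing.Theory Num.Theory.
Local Open Scope ring_scope.
Local Open Scope classical_set_scope.

Definition calibrated (R : realType) (T : nat) (x : 'I_T -> bool)
    (q : 'I_T -> R) : Prop :=
  (forall t, 0 <= q t <= 1) /\
  (forall alpha : R, 0 <= alpha <= 1 ->
     \sum_(t < T) ((x t)%:R - q t) * (q t == alpha)%:R = 0).

Definition l1dist (R : realType) (T : nat) (p q : 'I_T -> R) : R :=
  \sum_(t < T) `|p t - q t|.

(* CalDist(x,p) = min_{q in C(x)} ||p - q||_1.  C(x) is finite and
   nonempty, so this infimum is attained (it is the minimum). *)
Definition CalDist (R : realType) (T : nat) (x : 'I_T -> bool)
    (p : 'I_T -> R) : R :=
  inf [set d : R | exists q, calibrated x q /\ d = l1dist p q].

(* Model of computation: a real-RAM (BSS-style) register machine.      *)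
(* Real registers hold reals (exact +,-,*,/ and comparisons, rational  *)
(* constants); nat registers hold naturals (constants, +, truncated -, *)
(* comparisons) and are used for indirect addressing. Each executed    *)
(* instruction costs one time step.                                    *)

Inductive instr : Type :=
| RConst of nat & rat
| RAdd of nat & nat & nat
| RSub of nat & nat & nat
| RMul of nat & nat & nat
| RDiv of nat & nat & nat       (* R[d] := R[a] / R[b]  (x/0 = 0) *)
| RLoad of nat & nat
| RStore of nat & nat
| NConst of nat & nat
| NAdd of nat & nat & nat
| NSub of nat & nat & nat       (* N[d] := N[a] - N[b] (truncated) *)
| NLoad of nat & nat
| NStore of nat & nat
| JmpRLt of nat & nat & nat
| JmpREq of nat & nat & nat
| JmpNLt of nat & nat & nat
| JmpNEq of nat & nat & nat
| Jmp of nat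
| Halt.

Definition program := seq instr.

Record mstate (R : realType) := MState {
  pc : nat; rmem : nat -> R; nmem : nat -> nat }.

Definition upd {A : Type} (m : nat -> A) (d : nat) (v : A) : nat -> A :=
  fun i => if i == d then v else m i.

Definition exec (R : realType) (i : instr) (s : mstate R) : mstate R :=
  let: MState k r n := s in
  let nx := k.+1 in
  match i with
  | RConst d q => MState nx (upd r d (ratr q)) n
  | RAdd d a b => MState nx (upd r d (r a + r b)) n
  | RSub d a b => MState nx (upd r d (r a - r b)) n
  | RMul d a b => MState nx (upd r d (r a * r b)) n
  | RDiv d a b => MState nx (upd r d (r a / r b)) n
  | RLoad d a => MState nx (upd r d (r (n a))) n
  | RStore a s' => MState nx (upd r (n a) (r s')) n
  | NConst d c => MState nx r (upd n d c)
  | NAdd d a b => MState nx r (upd n d (n a + n b)%N)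
  | NSub d a b => MState nx r (upd n d (n a - n b)%N)
  | NLoad d a => MState nx r (upd n d (n (n a)))
  | NStore a s' => MState nx r (upd n (n a) (n s'))
  | JmpRLt a b l => MState (if r a < r b then l else nx) r n
  | JmpREq a b l => MState (if r a == r b then l else nx) r n
  | JmpNLt a b l => MState (if (n a < n b)%N then l else nx) r n
  | JmpNEq a b l => MState (if n a == n b then l else nx) r n
  | Jmp l => MState l r n
  | Halt => s
  end.

(* [run P fuel s] = Some v iff P, started in s, reaches Halt (or runs off
   the end of the program) after executing fewer than [fuel] instructions;
   v is then the content of real register 0 (the output). *)
Fixpoint run (R : realType) (P : program) (fuel : nat) (s : mstate R)
    : option R :=
  match fuel with
  | 0 => None
  | f.+1 =>
      match nth Halt P (pc s) with
      | Halt => Some (rmem s 0)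
      | i => run P f (exec i s)
      end
  end.

(* Input encoding: N[0] = T; R[t] = p_t and R[T + t] = x_t (as 0/1)
   for t < T; all other registers 0; pc = 0. *)
Definition init_state (R : realType) (T : nat) (x : 'I_T -> bool)
    (p : 'I_T -> R) : mstate R :=
  MState 0
    (fun i => if (insub i : option 'I_T) is Some t then p t
              else if (insub (i - T)%N : option 'I_T) is Some t
                   then (x t)%:R else 0)
    (fun i => if i == 0%N then T else 0%N).

(* Main.v *)
Require Import Defs.
From HB Require Import structures.
From mathcomp Require Import all_boot all_order all_algebra all_fingroup.
From mathcomp Require Import boolp classical_sets reals.
From mathcomp Require Import finset.
From mathcomp Require Import zify ring lra.
Set Implicit Arguments. Unset Strict Implicit. Unset Printing Implicit Defensive.
Import Order.TTheory GRing.Theory Num.Theory.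
Local Open Scope ring_scope.

(* On a real RAM the calibration distance can even be computed exactly. Swapping
   two values of a calibrated q between rounds with the same outcome keeps it
   calibrated, and undoing an inversion does not increase the distance to p, so
   q may be taken monotone in p on the zeros and on the ones. Its level sets then
   cut the sorted zeros and the sorted ones into consecutive blocks, i.e. they
   form a monotone lattice path from (0, 0) to (number of zeros, number of ones),
   and calibration forces the value of a block to be its fraction of ones.
   Conversely every such path gives a calibrated q. Hence CalDist is a shortest
   path length on a grid with at most (T + 1)^2 nodes, with edge weights
   \sum_t |p_t - v| over a block with value v.

   The shortest path recursion is written in a small expression language in which
   every loop runs exactly T + 1 times, so that running times are given by the
   syntax alone. *)

(** * The shortest path problem *)

Section DynamicProgram.
Variables (R : realType) (T : nat) (x : 'I_T -> bool) (p : 'I_T -> R).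

(** Ties in [p] are broken by index, which makes this a strict total order on each outcome class;
    [rk] then numbers each class consecutively from 0. *)
Definition before (s t : 'I_T) : bool :=
  (x s == x t) && ((p s < p t) || ((p s == p t) && (s < t)%N)).

Definition rk (t : 'I_T) : nat := #|[set s | before s t]|.

Definition cls (c : bool) (D : {set 'I_T}) : nat := #|[set t in D | x t == c]|.

(* The [a] first zeros and the [b] first ones. *)
Definition prefix_set (a b : nat) : {set 'I_T} :=
  [set t | (rk t < if x t then b else a)%N].

Definition block (a' b' a b : nat) : {set 'I_T} :=
  [set t | (~~ (rk t < if x t then b' else a') && (rk t < if x t then b else a))%N].

Definition blockval (a' b' a b : nat) : R :=
  (b%:R - b'%:R) / ((a%:R - a'%:R) + (b%:R - b'%:R)).

Definition blockcost (a' b' a b : nat) : R :=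
  \sum_(t in block a' b' a b) `|p t - blockval a' b' a b|.

(** * Ranks and initial segments of the two classes *)

Lemma before_trans : transitive before.
Proof.
move=> t s u /andP[/eqP e1 h1] /andP[/eqP e2 h2]; rewrite /before e1 e2 eqxx /=.
case/orP: h1 => [h1|/andP[/eqP e3 h1]]; case/orP: h2 => [h2|/andP[/eqP e4 h2]].
- by rewrite (lt_trans h1 h2).
- by rewrite -e4 h1.
- by rewrite e3 h2.
- by rewrite e3 e4 eqxx (ltn_trans h1 h2) orbT.
Qed.

Lemma before_irr t : before t t = false.
Proof. by rewrite /before ltxx ltnn !andbF. Qed.

Lemma before_total s t : x s = x t -> s != t -> before s t || before t s.
Proof.
move=> e ne; rewrite /before e eqxx /= [p t == _]eq_sym; case: ltgtP => //= _.
by rewrite -neq_ltn.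
Qed.

Lemma rk_lt s t : before s t -> (rk s < rk t)%N.
Proof.
move=> st; apply: proper_card; apply/properP; split.
  by apply/fintype.subsetP => u; rewrite !inE => us; exact: before_trans st.
by exists s; rewrite !inE ?before_irr.
Qed.

Lemma rk_inj s t : x s = x t -> rk s = rk t -> s = t.
Proof.
move=> e er; apply/eqP/negPn/negP => /(before_total e) /orP[] /rk_lt;
by rewrite er ltnn.
Qed.

(** If [t] lies in [D], its predecessors and [t] itself are all counted, so the count exceeds
    [rk t]. If not, totality puts every member of [D] in the class of [t] before [t]. *)
Lemma rk_downset (D : {set 'I_T}) : (forall s t, t \in D -> before s t -> s \in D) ->
  forall t, (t \in D) = (rk t < cls (x t) D)%N.
Proof.
move=> hD t; apply/idP/idP => [tD|].
- apply: proper_card; apply/properP; split.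
    by apply/fintype.subsetP => s; rewrite !inE => st; rewrite (hD _ _ tD st); case/andP: st.
  by exists t; rewrite !inE ?before_irr // tD eqxx.
- apply: contraTT => tD; rewrite -leqNgt; apply: subset_leq_card.
  apply/fintype.subsetP => s; rewrite !inE => /andP[sD /eqP xs].
  have /(before_total xs)/orP[//|ts] : s != t by apply: contraNneq tD => <-.
  by rewrite (hD _ _ sD ts) in tD.
Qed.

Lemma rk_lt_cls t : (rk t < cls (x t) setT)%N.
Proof. by rewrite -rk_downset ?inE // => s u; rewrite !inE. Qed.

(** The ranks in class [c] are distinct and below the class size, hence a permutation of
    [iota 0 (cls c setT)], and exactly [n] of them are below [n]. *)
Lemma cls_prefix a b c : (a <= cls false setT)%N -> (b <= cls true setT)%N ->
  cls c (prefix_set a b) = if c then b else a.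
Proof.
move=> ha hb; set n := if c then b else a.
have hn : (n <= cls c setT)%N by rewrite /n; case: (c).
pose A := [set t in [set: 'I_T] | x t == c].
have -> : cls c (prefix_set a b) = count (fun i => i < n)%N [seq rk t | t <- enum A].
  rewrite count_map -size_filter /cls cardE /enum_mem -filter_predI; congr size.
  apply: eq_filter => t; rewrite /= !inE /n; case: eqP => [->|]; rewrite ?andbF //=.
have szA : size [seq rk t | t <- enum A] = cls c setT by rewrite size_map -cardE.
have uA : uniq [seq rk t | t <- enum A].
  rewrite map_inj_in_uniq ?enum_uniq // => s t; rewrite !mem_enum !inE.
  by move=> /eqP e1 /eqP e2; apply: rk_inj; rewrite e1 e2.
have sub : {subset [seq rk t | t <- enum A] <= iota 0 (cls c setT)}.
  move=> i /mapP[t]; rewrite mem_enum !inE => /eqP <- ->.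
  by rewrite mem_iota rk_lt_cls.
have [|_ e] := uniq_min_size uA sub; first by rewrite szA size_iota.
have /seq.permP-> : perm_eq [seq rk t | t <- enum A] (iota 0 (cls c setT)).
  by apply: uniq_perm => //; exact: iota_uniq.
by rewrite -size_filter (filter_iota_ltn 0 hn) size_iota.
Qed.

(** * Rearrangement of a calibrated sequence *)

Lemma exchange_dist (a b c d : R) : a <= b -> d <= c ->
  `|a - d| + `|b - c| <= `|a - c| + `|b - d|.
Proof.
move=> ab dc; case: (ger0P (a - d)) => ?; case: (ger0P (b - c)) => ?;
case: (ger0P (a - c)) => ?; case: (ger0P (b - d)) => ?; lra.
Qed.

(** The summand [f] is left general because the swap is applied both to the distance and to the
    correlation with the ranks. *)
Lemma sum_tperm (q : 'I_T -> R) (f : 'I_T -> R -> R) s t : s != t ->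
  \sum_u f u (q (tperm s t u)) =
  \sum_u f u (q u) + (f s (q t) + f t (q s) - f s (q s) - f t (q t)).
Proof.
move=> st; rewrite (bigD1 s) //= (bigD1 t) 1?eq_sym //=.
rewrite [in RHS](bigD1 s) //= [in RHS](bigD1 t) 1?eq_sym //=.
rewrite tpermL tpermR.
rewrite (eq_bigr (fun u => f u (q u))); first by ring.
by move=> u /andP[us ut]; rewrite tpermD // eq_sym.
Qed.

(* Among the rearrangements of [q] within the two classes that minimise the
   distance to [p], take one that correlates best with the ranks: an inversion
   could be swapped to increase the correlation. *)
Lemma monotone_rearrangement (q : 'I_T -> R) : calibrated x q ->
  exists q', [/\ calibrated x q', l1dist p q' <= l1dist p q
               & forall s t, before s t -> q' s <= q' t].
Proof.
case=> q01 qc; pose ok (g : {perm 'I_T}) := [forall t, x (g t) == x t].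
pose dist (g : {perm 'I_T}) := l1dist p (q \o g).
pose corr (g : {perm 'I_T}) : R := \sum_t (rk t)%:R * q (g t).
have ok1 : ok 1%g by apply/forallP => t; rewrite perm1.
case: (arg_minP dist ok1) => g okg ming.
have okg' : ok g && (dist g <= dist g) by rewrite okg lexx.
case: (@arg_maxP _ _ _ g (fun k => ok k && (dist k <= dist g)) corr okg') => k /andP[okk dk] maxk.
have xk t : x (k t) = x t by apply/eqP; move/forallP: okk; apply.
exists (q \o k); split.
- split=> [t|alpha /qc h]; first exact: q01.
  apply: etrans h.
  by rewrite [RHS](reindex_inj (@perm_inj _ k)) /=; apply: eq_bigr => t _; rewrite xk.
- change (dist k <= l1dist p q); apply: (le_trans dk); apply: le_trans (ming _ ok1) _.
  rewrite (_ : dist _ = l1dist p q) // /dist; congr l1dist.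
  by apply/funext => t /=; rewrite perm1.
- move=> s t st; rewrite leNgt; apply/negP => /= qst.
  have ne : s != t by apply: contraTneq st => ->; rewrite before_irr.
  have xst : x s = x t by case/andP: st => /eqP.
  have pst : p s <= p t.
    by case/andP: st => _ /orP[/ltW//|/andP[/eqP-> _]].
  pose k' := (tperm s t * k)%g.
  have k'E u : k' u = k (tperm s t u) by rewrite permM.
  have okk' : ok k'.
    by apply/forallP => u; rewrite k'E xk; case: tpermP => [->|->|]; rewrite ?xst.
  have dk' : dist k' <= dist k.
    rewrite /dist /l1dist; under eq_bigr do rewrite /= k'E.
    rewrite (sum_tperm (q \o k) (fun u z => `|p u - z|) ne) /=.
    by have := exchange_dist pst (ltW qst); lra.
  have /maxk : ok k' && (dist k' <= dist g) by rewrite okk' (le_trans dk').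
  have -> : corr k' = \sum_u (rk u)%:R * (q \o k) (tperm s t u).
    by apply: eq_bigr => u _; rewrite k'E.
  rewrite (sum_tperm (q \o k) (fun u z => (rk u)%:R * z) ne) /= -/(corr k).
  (* The swap changes the correlation by [(rk t - rk s) * (q (k s) - q (k t))], which is positive at
     an inversion and contradicts maximality. *)
  have : (rk s)%:R < (rk t)%:R :> R by rewrite ltr_nat rk_lt.
  move=> h; rewrite leNgt => /negP; apply.
  have : 0 < ((rk t)%:R - (rk s)%:R) * (q (k s) - q (k t)) by rewrite mulr_gt0 // subr_gt0.
  lra.
Qed.

(** * Solutions of the Bellman equations *)

Variable G : nat -> nat -> R.

(* [G a b] is the least cost of a monotone lattice path from [(0, 0)] to
   [(a, b)]. The first clause is the step from [(0, 0)], where [G] vanishes; at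
   [(a, b) = (0, 0)] its block is empty and the block value is the junk [0 / 0]. *)
Definition bellman_at (a b : nat) : Prop :=
  [/\ G a b <= blockcost 0 0 a b,
   forall a' b', (a' <= a)%N -> (b' <= b)%N -> (a', b') != (a, b) ->
     G a b <= G a' b' + blockcost a' b' a b
   & G a b = blockcost 0 0 a b \/
     exists a' b', [/\ (a' <= a)%N, (b' <= b)%N, (a', b') != (a, b)
                     & G a b = G a' b' + blockcost a' b' a b]].

Hypothesis GP : forall a b, (a <= T)%N -> (b <= T)%N -> bellman_at a b.

Lemma block_empty a b : block a b a b = set0.
Proof. by apply/setP => t; rewrite !inE andNb. Qed.

Lemma G00 : G 0 0 = 0.
Proof.
have [_ _] := GP (leq0n T) (leq0n T).
rewrite {1}/blockcost block_empty big_set0 => -[//|[a' [b' []]]].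
by rewrite !leqn0 => /eqP-> /eqP->; rewrite eqxx.
Qed.

Lemma cls_le c D : (cls c D <= T)%N.
Proof. by rewrite /cls (leq_trans (max_card _)) // card_ord. Qed.

Lemma cls0D D : (cls false D + cls true D = #|D|)%N.
Proof.
rewrite /cls -(cardsID [set t | x t] D) addnC; congr addn; apply: eq_card => t;
by rewrite !inE; case: (x t); rewrite ?andbT ?andbF.
Qed.

Lemma clsU c (A B : {set 'I_T}) : [disjoint A & B] -> cls c (A :|: B) = (cls c A + cls c B)%N.
Proof.
move=> dAB; rewrite /cls !setIdE setIUl cardsU -setIIl.
by rewrite (disjoint_setI0 dAB) set0I cards0 subn0.
Qed.

Lemma sumU (f : 'I_T -> R) (A B : {set 'I_T}) : [disjoint A & B] ->
  \sum_(t in A :|: B) f t = \sum_(t in A) f t + \sum_(t in B) f t.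
Proof. by move=> dAB; rewrite -bigU //=; apply: eq_bigl => t; rewrite !inE. Qed.

Lemma sum_setT (f : 'I_T -> R) : \sum_(t in setT) f t = \sum_t f t.
Proof. by apply: eq_bigl => t; rewrite inE. Qed.

Lemma sum_x (D : {set 'I_T}) : \sum_(t in D) (x t)%:R = (cls true D)%:R :> R.
Proof.
rewrite /cls -sum1_card natr_sum (big_setID [set t | x t]) /=.
rewrite [X in _ + X]big1 ?addr0; last by move=> t; rewrite !inE => /andP[/negbTE->].
apply: eq_big => t; first by rewrite !inE; case: (x t).
by rewrite !inE => /andP[_ ->].
Qed.

(** Peel off the level set [B] of the largest value [v] of [q] on [D]. What remains is again a
    sublevel set, so by monotonicity both sets are initial segments in each class and [B] is a
    block. The Bellman inequality for this block closes the induction. *)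
Lemma G_le (q : 'I_T -> R) (D : {set 'I_T}) : calibrated x q ->
  (forall s t, before s t -> q s <= q t) ->
  (forall s t, t \in D -> q s <= q t -> s \in D) ->
  G (cls false D) (cls true D) <= \sum_(t in D) `|p t - q t|.
Proof.
case=> q01 qc qm; move: D; suff H n (D : {set 'I_T}) : (#|D| <= n)%N ->
    (forall s t, t \in D -> q s <= q t -> s \in D) ->
    G (cls false D) (cls true D) <= \sum_(t in D) `|p t - q t|.
  by move=> D; exact: (H #|D|).
elim: n D => [|n IH] D Dn hD.
  have -> : D = set0 by apply/eqP; rewrite -cards_eq0 -leqn0.
  rewrite big_set0 /cls; suff e c : [set t in set0 | x t == c] = set0 :> {set 'I_T}.
    by rewrite !e cards0 G00.
  by apply/setP => t; rewrite !inE.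
have [D0|[t0 t0D]] := set_0Vmem D; first by apply: IH; rewrite // D0 cards0.
case: (arg_maxP q t0D) => t1 t1D' maxt1; have t1D : t1 \in D := t1D'; pose v := q t1.
pose D' := [set t in D | q t < v]; pose B := [set t in D | q t == v].
have D'D : (#|D'| < #|D|)%N.
  apply: proper_card; apply/properP; split.
    by apply/fintype.subsetP => t; rewrite inE => /andP[].
  by exists t1; rewrite ?inE ?ltxx ?andbF.
have hD' s t : t \in D' -> q s <= q t -> s \in D'.
  rewrite !inE => /andP[tD tv] st; rewrite (hD _ _ tD st) /=.
  exact: le_lt_trans st tv.
have DB t : (t \in B) = (t \in D) && (t \notin D').
  rewrite !inE; case tD: (t \in D) => //=; rewrite -leNgt eq_le.
  by have -> : q t <= v := maxt1 t tD.
have before_D (E : {set 'I_T}) : (forall s t, t \in E -> q s <= q t -> s \in E) ->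
    forall s t, t \in E -> before s t -> s \in E.
  by move=> hE s t tE /qm; exact: hE.
have rkD := rk_downset (before_D _ hD); have rkD' := rk_downset (before_D _ hD').
set a' := cls false D'; set b' := cls true D'; set a := cls false D; set b := cls true D.
have blkE : block a' b' a b = B.
  apply/setP => t; rewrite DB rkD rkD' inE andbC.
  by rewrite /a /b /a' /b'; case: (x t).
have cls_mono c : (cls c D' <= cls c D)%N.
  apply: subset_leq_card; apply/fintype.subsetP => t; rewrite !inE.
  by case/andP => /andP[-> _] ->.
have DBD : D = D' :|: B.
  by apply/setP => t; rewrite inE DB; case tD': (t \in D') => //=;
     [move: tD'; rewrite inE => /andP[->]|rewrite andbT].
have disj : [disjoint D' & B].
  by rewrite -setI_eq0; apply/eqP/setP => t; rewrite inE DB !inE; case: (t \in D); rewrite ?andbF ?andbN.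
have cB c : (cls c D = cls c D' + cls c B)%N by rewrite {1}DBD clsU.
(* [D] is closed downwards under [q], so it contains every round with value [v]; the sum over [B] is
   the full calibration condition at [v]. *)
have sumB : \sum_(t in B) ((x t)%:R - v) = 0 :> R.
  rewrite -[RHS](qc v (q01 t1)); rewrite [RHS](bigID (fun t => q t == v)) /=.
  rewrite [X in _ = _ + X]big1 ?addr0; last by move=> t /negbTE ->; rewrite mulr0.
  apply: eq_big => [t|t]; last by rewrite !inE => /andP[_ /eqP->]; rewrite eqxx mulr1.
  rewrite !inE; case: eqP => [qt|]; rewrite ?andbF // andbT.
  by apply: hD t1D _; rewrite qt.
have B0 : (0 < #|B|)%N by apply/card_gt0P; exists t1; rewrite DB t1D inE ltxx andbF.
(* The vanishing sum says that the number of ones in [B] is [v] times the size of [B]. *)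
have vE : blockval a' b' a b = v.
  rewrite /blockval /a /b /a' /b' !cB !natrD -[X in _ / (X + _)]/(_ + _ - _).
  rewrite ![(cls _ D')%:R + _]addrC !addrK -natrD cls0D.
  move: sumB; rewrite sumrB sum_x sumr_const => /eqP; rewrite subr_eq0 => /eqP->.
  by rewrite -[v *+ _]mulr_natr mulfK // pnatr_eq0 -lt0n.
have [_ /(_ a' b' (cls_mono _) (cls_mono _)) le1 _] := GP (cls_le false D) (cls_le true D).
have ne : (a', b') != (a, b).
  by apply: contraTneq D'D => -[ea eb]; rewrite -!cls0D -/a -/b -/a' -/b' ea eb ltnn.
apply: le_trans (le1 ne) _.
have -> : \sum_(t in D) `|p t - q t| = \sum_(t in D') `|p t - q t| + \sum_(t in B) `|p t - q t|.
  by rewrite {1}DBD sumU.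
apply: lerD.
  by apply: IH => //; lia.
rewrite /blockcost blkE vE le_eqVlt; apply/orP; left; apply/eqP/eq_bigr => t.
by rewrite !inE => /andP[_ /eqP->].
Qed.

(** An optimal path is traced back through the equality clause of [bellman_at], and [q] takes the
    block value on the last block. Bounding [a] and [b] by the class sizes ensures that this block
    really has [a - a'] zeros and [b - b'] ones, so that its value is its fraction of ones. *)
Lemma G_attained a b : (a <= cls false setT)%N -> (b <= cls true setT)%N ->
  exists q : 'I_T -> R, [/\ forall t, 0 <= q t <= 1,
    forall alpha, \sum_(t in prefix_set a b) ((x t)%:R - q t) * (q t == alpha)%:R = 0
    & \sum_(t in prefix_set a b) `|p t - q t| = G a b].
Proof.
have [n] := ubnP (a + b)%N; elim: n a b => // n IH a b ln ha hb.
have [aT bT] : (a <= T)%N /\ (b <= T)%N.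
  by rewrite (leq_trans ha (cls_le _ _)) (leq_trans hb (cls_le _ _)).
have [/andP[/eqP a0 /eqP b0]|ab0] := boolP ((a == 0)%N && (b == 0)%N).
  have e : prefix_set a b = set0.
    by apply/setP => t; rewrite !inE a0 b0; case: (x t).
  exists (fun=> 0); rewrite e a0 b0 G00 !big_set0; split=> // *.
    by rewrite lexx ler01.
  by rewrite big_set0.
(* The direct step from the origin is also a predecessor step, since [G 0 0 = 0]. *)
have [a' [b' [aa bb ne Ge]]] : exists a' b', [/\ (a' <= a)%N, (b' <= b)%N, (a', b') != (a, b)
                     & G a b = G a' b' + blockcost a' b' a b].
  have [_ _ [->|//]] := GP aT bT; exists 0%N, 0%N; split=> //; last by rewrite G00 add0r.
  by rewrite xpair_eqE ![(0 == _)%N]eq_sym.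
have lt : (a' + b' < a + b)%N.
  by rewrite xpair_eqE in ne; lia.
have [|||q [q01 qc qG]] := IH a' b' => //; try lia.
set v := blockval a' b' a b; set D := prefix_set a b; set D' := prefix_set a' b'.
pose B := block a' b' a b.
have BE t : (t \in B) = (t \in D) && (t \notin D') by rewrite !inE andbC.
have D'D : D' \subset D.
  apply/fintype.subsetP => t; rewrite !inE; case: (x t) => h; exact: leq_trans h _.
have disj : [disjoint D' & B].
  by rewrite -setI_eq0; apply/eqP/setP => t; rewrite in_setI BE in_set0; case: (t \in D'); rewrite ?andbF.
have DBD : D = D' :|: B.
  apply/setP => t; rewrite in_setU BE; case tD': (t \in D') => //=.
    by rewrite (fintype.subsetP D'D).
  by rewrite andbT.
have cB c : (cls c D = cls c D' + cls c B)%N by rewrite {1}DBD clsU.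
have ca : (a = a' + cls false B)%N.
  by have := cB false; rewrite !cls_prefix //; lia.
have cb : (b = b' + cls true B)%N.
  by have := cB true; rewrite !cls_prefix //; lia.
have B0 : (0 < #|B|)%N by rewrite -cls0D; lia.
have vE : v = (cls true B)%:R / #|B|%:R.
  have ea : a%:R - a'%:R = (cls false B)%:R :> R by rewrite [X in X%:R - _]ca natrD addrC addKr.
  have eb : b%:R - b'%:R = (cls true B)%:R :> R by rewrite [X in X%:R - _]cb natrD addrC addKr.
  by rewrite /v /blockval ea eb -natrD cls0D.
have sumB : \sum_(t in B) ((x t)%:R - v) = 0 :> R.
  rewrite sumrB sum_x sumr_const -[v *+ _]mulr_natr vE divfK ?subrr //.
  by rewrite pnatr_eq0 -lt0n.
exists (fun t => if t \in B then v else q t); split.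
- move=> t; case: ifP => _ //; rewrite vE divr_ge0 ?ler0n //=.
  by rewrite ler_pdivrMr ?ltr0n // mul1r ler_nat -cls0D leq_addl.
(* The new block contributes zero for every [alpha], so it does no harm if [v] is already a value of
   [q] on [D']. *)
- move=> alpha; rewrite DBD sumU // [X in X + _](_ : _ = 0) ?add0r.
    rewrite (eq_bigr (fun t => ((x t)%:R - v) * (v == alpha)%:R)); last by move=> t ->.
    by rewrite -mulr_suml sumB mul0r.
  apply: etrans (qc alpha); apply: eq_bigr => t tD'.
  by rewrite (disjointFr disj tD').
- rewrite DBD sumU // Ge -qG /blockcost -/B -/v; congr (_ + _); apply: eq_bigr => t.
    by move=> tD'; rewrite (disjointFr disj tD').
  by move=> ->.
Qed.

Lemma CalDist_dp : CalDist x p = G (cls false setT) (cls true setT).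
Proof.
rewrite /CalDist; set g := G _ _; set S := (X in inf X).
have lbS : lbound S g.
  move=> d [q [qc ->]]; have [q' [qc' le qm]] := monotone_rearrangement qc.
  apply: le_trans le; rewrite /l1dist.
  by have := G_le qc' qm (D := setT); rewrite sum_setT; apply => s t; rewrite !inE.
have Sg : S g.
  have [q [q01 qc qG]] := G_attained (leqnn _) (leqnn _).
  have e : prefix_set (cls false setT) (cls true setT) = setT.
    apply/setP => t; rewrite !inE; have := rk_lt_cls t; by case: (x t).
  exists q; split; last by rewrite /l1dist /g -qG e sum_setT.
  by split=> // alpha _; apply: etrans (qc alpha); rewrite e sum_setT.
apply/eqP; rewrite eq_le; apply/andP; split.
  by apply: ge_inf => //; exists g.
by apply: lb_le_inf => //; exists g.
Qed.

End DynamicProgram.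

(** * Structured programs *)

(* [SFor v s] counts register [v] from 0 up to [N[1]]; it tests at the end of
   the body and increments by [N[2]], so it needs [0 < N[1]] and [N[2] = 1]. *)
Inductive stmt : Type :=
| SI of instr
| SSeq of stmt & stmt
| SIfR of nat & nat & stmt & stmt
| SIfN of nat & nat & stmt & stmt
| SFor of nat & stmt.

Fixpoint slen (s : stmt) : nat :=
  match s with
  | SI _ => 1
  | SSeq s1 s2 => slen s1 + slen s2
  | SIfR _ _ s1 s2 | SIfN _ _ s1 s2 => slen s2 + slen s1 + 2
  | SFor _ s => slen s + 3
  end.

(** Jump targets are absolute, so the code depends on its load address [k]. The conditional jump is
    taken when the test succeeds; hence the else branch [s2] is laid out first. *)
Fixpoint scode (k : nat) (s : stmt) : seq instr :=
  match s with
  | SI i => [:: i]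
  | SSeq s1 s2 => scode k s1 ++ scode (k + slen s1) s2
  | SIfR a b s1 s2 =>
      JmpRLt a b (k + slen s2 + 2) :: scode k.+1 s2 ++
      Jmp (k + slen s2 + slen s1 + 2) :: scode (k + slen s2 + 2) s1
  | SIfN a b s1 s2 =>
      JmpNLt a b (k + slen s2 + 2) :: scode k.+1 s2 ++
      Jmp (k + slen s2 + slen s1 + 2) :: scode (k + slen s2 + 2) s1
  | SFor v s =>
      NConst v 0 :: scode k.+1 s ++ [:: NAdd v v 2; JmpNLt v 1 k.+1]
  end.

(** Both branches of a conditional are charged, so the bound depends on [M] and the syntax alone,
    not on the memory. *)
Fixpoint stime (M : nat) (s : stmt) : nat :=
  match s with
  | SI _ => 1
  | SSeq s1 s2 => stime M s1 + stime M s2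
  | SIfR _ _ s1 s2 | SIfN _ _ s1 s2 => stime M s1 + stime M s2 + 2
  | SFor _ s => 1 + M * (stime M s + 2)
  end.

Lemma size_scode s k : size (scode k s) = slen s.
Proof.
elim: s k => //= [s1 h1 s2 h2|a b s1 h1 s2 h2|a b s1 h1 s2 h2|v s h] k;
  rewrite ?size_cat /= ?size_cat /= ?h1 ?h2 ?h /=; lia.
Qed.

(** A loop raises the exponent by one; sequencing and branching add exponents, which is crude but
    keeps the bound polynomial. *)
Lemma stime_poly s :
  exists c k, forall M, (0 < M)%N -> (stime M s <= c * M ^ k)%N.
Proof.
have le2 c1 k1 c2 k2 (f g : nat -> nat) :
    (forall M, 0 < M -> f M <= c1 * M ^ k1)%N ->
    (forall M, 0 < M -> g M <= c2 * M ^ k2)%N ->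
    forall M, (0 < M -> f M + g M + 2 <= (c1 + c2 + 2) * M ^ (k1 + k2))%N.
  move=> hf hg M M0; have := hf M M0; have := hg M M0.
  have e1 : (M ^ k1 <= M ^ (k1 + k2))%N by rewrite leq_pexp2l // leq_addr.
  have e2 : (M ^ k2 <= M ^ (k1 + k2))%N by rewrite leq_pexp2l // leq_addl.
  have e3 : (0 < M ^ (k1 + k2))%N by rewrite expn_gt0 M0.
  by nia.
elim: s => [i|s1 [c1 [k1 h1]] s2 [c2 [k2 h2]]|a b s1 [c1 [k1 h1]] s2 [c2 [k2 h2]]|a b s1 [c1 [k1 h1]] s2 [c2 [k2 h2]]|v s [c [k h]]] /=.
- by exists 1%N, 0%N => M _; rewrite muln1.
- exists (c1 + c2 + 2)%N, (k1 + k2)%N => M M0.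
  by apply: leq_trans (le2 _ _ _ _ _ _ h1 h2 M M0); rewrite leq_addr.
- by exists (c1 + c2 + 2)%N, (k1 + k2)%N => M M0; exact: (le2 _ _ _ _ _ _ h1 h2 M M0).
- by exists (c1 + c2 + 2)%N, (k1 + k2)%N => M M0; exact: (le2 _ _ _ _ _ _ h1 h2 M M0).
- exists (c + 3)%N, k.+1 => M M0; have := h M M0.
  have e3 : (0 < M ^ k)%N by rewrite expn_gt0 M0.
  rewrite expnS; set X := (M ^ k)%N in e3 *; set Y := stime M s => hY.
  have : (M * (Y + 2) <= M * (c * X + 2 * X))%N by rewrite leq_mul2l; apply/orP; right; lia.
  have : (M * X > 0)%N by rewrite muln_gt0 M0.
  nia.
Qed.

(** * Total correctness of structured programs *)

Definition memory (R : realType) : Type := ((nat -> R) * (nat -> nat))%type.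

Definition state (R : realType) (k : nat) (m : memory R) := MState k m.1 m.2.

Definition simple (i : instr) : bool :=
  match i with
  | JmpRLt _ _ _ | JmpREq _ _ _ | JmpNLt _ _ _ | JmpNEq _ _ _ | Jmp _ | Halt => false
  | _ => true
  end.

Definition effect (R : realType) (i : instr) (m : memory R) : memory R :=
  let s := exec i (state 0 m) in (rmem s, nmem s).

Definition code_at (P : program) (k : nat) (c : seq instr) : Prop :=
  exists P1 P2, P = P1 ++ c ++ P2 /\ size P1 = k.

Lemma code_at_catl P k c1 c2 : code_at P k (c1 ++ c2) -> code_at P k c1.
Proof. by case=> P1 [P2 [-> hk]]; exists P1, (c2 ++ P2); rewrite -!catA. Qed.

Lemma code_at_catr P k c1 c2 : code_at P k (c1 ++ c2) -> code_at P (k + size c1) c2.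
Proof.
by case=> P1 [P2 [-> <-]]; exists (P1 ++ c1), P2; rewrite -!catA size_cat.
Qed.

Lemma code_at_cons P k i c : code_at P k (i :: c) ->
  nth Halt P k = i /\ code_at P k.+1 c.
Proof.
move=> h; split; last by rewrite -addn1; exact: (@code_at_catr P k [:: i] c).
by case: h => P1 [P2 [-> <-]]; rewrite nth_cat ltnn subnn.
Qed.

(** Total correctness with a time bound. The final memory is chosen before the program and the load
    address, and the leftover fuel [f] is arbitrary, so that consecutive pieces of code can be
    chained. *)
Definition wp (R : realType) (M : nat) (s : stmt) (m : memory R) (Q : memory R -> Prop) : Prop :=
  exists2 m', Q m' & forall P k, code_at P k (scode k s) ->
    exists2 n, (n <= stime M s)%N & forall f,
      run P (n + f) (state k m) = run P f (state (k + slen s) m').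

Lemma code_at_self P : code_at P 0 P.
Proof. by exists [::], [::]; rewrite cats0. Qed.

Lemma run_end (R : realType) P f (m : memory R) :
  run P f.+1 (state (size P) m) = Some (m.1 0%N).
Proof. by rewrite /= nth_default. Qed.

Section Wp.
Variables (R : realType) (M : nat).
Implicit Types (m : memory R) (Q : memory R -> Prop).

Lemma wp_mono s m Q Q' : (forall m', Q m' -> Q' m') -> wp M s m Q -> wp M s m Q'.
Proof. by move=> h [m' /h qm' e]; exists m'. Qed.

Lemma wp_instr i m Q : simple i -> Q (effect i m) -> wp M (SI i) m Q.
Proof.
move=> si hQ; exists (effect i m) => // P k /code_at_cons[hi _].
exists 1%N => // f; rewrite /= hi addn1.
by case: i si {hQ hi}.
Qed.

Lemma wp_seq s1 s2 m Q : wp M s1 m (fun m' => wp M s2 m' Q) -> wp M (SSeq s1 s2) m Q.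
Proof.
case=> m1 [m2 hQ h2] h1; exists m2 => // P k /= hc.
have [n1 l1 e1] := h1 P k (code_at_catl hc).
have := code_at_catr hc; rewrite size_scode => /h2 [n2 l2 e2].
exists (n1 + n2)%N; first exact: leq_add.
by move=> f; rewrite -addnA e1 e2 addnA.
Qed.

Lemma wp_ifR a b s1 s2 m Q :
  (m.1 a < m.1 b -> wp M s1 m Q) -> (~~ (m.1 a < m.1 b) -> wp M s2 m Q) ->
  wp M (SIfR a b s1 s2) m Q.
Proof.
move=> h1 h2; case hab: (m.1 a < m.1 b).
- have [m1 hQ e1] := h1 hab; exists m1 => // P k /= /code_at_cons[hi hc].
  have := code_at_catr hc; rewrite size_scode => /code_at_cons[_].
  have -> : (k.+1 + slen s2).+1 = (k + slen s2 + 2)%N by lia.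
  move=> /e1[n ln en]; exists n.+1; first by lia.
  move=> f; rewrite addSn /= hi /= hab en; congr run; congr state; lia.
- have [m1 hQ e1] := h2 (negbT hab); exists m1 => // P k /= /code_at_cons[hi hc].
  have [n ln en] := e1 _ _ (code_at_catl hc).
  have := code_at_catr hc; rewrite size_scode => /code_at_cons[hj _].
  exists (n + 2)%N; first by lia.
  move=> f; have -> : (n + 2 + f = (n + f.+1).+1)%N by lia.
  rewrite /= hi /= hab en /= hj /=; congr run; congr state; lia.
Qed.

Lemma wp_ifN a b s1 s2 m Q :
  (m.2 a < m.2 b -> wp M s1 m Q)%N -> (~~ (m.2 a < m.2 b)%N -> wp M s2 m Q) ->
  wp M (SIfN a b s1 s2) m Q.
Proof.
move=> h1 h2; case hab: (m.2 a < m.2 b)%N.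
- have [m1 hQ e1] := h1 hab; exists m1 => // P k /= /code_at_cons[hi hc].
  have := code_at_catr hc; rewrite size_scode => /code_at_cons[_].
  have -> : (k.+1 + slen s2).+1 = (k + slen s2 + 2)%N by lia.
  move=> /e1[n ln en]; exists n.+1; first by lia.
  move=> f; rewrite addSn /= hi /= hab en; congr run; congr state; lia.
- have [m1 hQ e1] := h2 (negbT hab); exists m1 => // P k /= /code_at_cons[hi hc].
  have [n ln en] := e1 _ _ (code_at_catl hc).
  have := code_at_catr hc; rewrite size_scode => /code_at_cons[hj _].
  exists (n + 2)%N; first by lia.
  move=> f; have -> : (n + 2 + f = (n + f.+1).+1)%N by lia.
  rewrite /= hi /= hab en /= hj /=; congr run; congr state; lia.
Qed.

(** [I i] describes the memory on entry to round [i], with the counter already set. The body must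
    preserve the counter, the bound and the increment; [v] must differ from 1 lest the increment
    overwrite the bound. *)
Lemma wp_for (I : nat -> memory R -> Prop) v s m Q : (0 < M)%N ->
  I 0%N (m.1, upd m.2 v 0%N) ->
  (forall i m', (i < M)%N -> I i m' -> m'.2 v = i ->
     wp M s m' (fun m2 => [/\ m2.2 v = i, m2.2 2%N = 1%N, v == 1%N = false, m2.2 1%N = M
                            & I i.+1 (m2.1, upd m2.2 v i.+1)])) ->
  (forall m', I M m' -> Q m') ->
  wp M (SFor v s) m Q.
Proof.
move=> M0 I0 IS IQ.
(* The test comes after the body, so the induction is on the number [j.+1] of rounds left and starts
   from a single round. *)
have loop j i m' : (i + j.+1 = M)%N -> I i m' -> m'.2 v = i ->
    exists2 m2, I M m2 & forall P k,
      code_at P k.+1 (scode k.+1 s ++ [:: NAdd v v 2; JmpNLt v 1 k.+1]) ->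
      exists2 n, (n <= j.+1 * (stime M s + 2))%N & forall f,
      run P (n + f) (state k.+1 m') = run P f (state (k + (slen s + 3)) m2).
  elim: j i m' => [|j IH] i m' ij Ii vi.
  - have iM : (i < M)%N by lia.
    have [m1 [v1 h2 v1N h1 I1] e1] := IS i m' iM Ii vi.
    exists (m1.1, upd m1.2 v i.+1); first by have -> : M = i.+1 by lia.
    move=> P k hc; have [n ln en] := e1 _ _ (code_at_catl hc).
    have := code_at_catr hc; rewrite size_scode.
    move=> /code_at_cons[ha] /code_at_cons[hb _].
    exists (n + 2)%N; first by lia.
    move=> f; have -> : (n + 2 + f = n + f.+2)%N by lia.
    rewrite en /= ha /= hb /= v1 h2 addn1 {1 2}/upd eqxx eq_sym v1N h1.
    have -> : (i.+1 < M)%N = false by lia.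
    by rewrite /state; congr run; congr MState; lia.
  - have iM : (i < M)%N by lia.
    have [m1 [v1 h2 v1N h1 I1] e1] := IS i m' iM Ii vi.
    have ij' : (i.+1 + j.+1 = M)%N by lia.
    have [//||m2 I2 e2] := IH i.+1 (m1.1, upd m1.2 v i.+1) ij'.
      by rewrite /= /upd eqxx.
    exists m2 => // P k hc; have [n ln en] := e1 _ _ (code_at_catl hc).
    have [n2 ln2 en2] := e2 P k hc.
    have := code_at_catr hc; rewrite size_scode.
    move=> /code_at_cons[ha] /code_at_cons[hb _].
    exists (n + 2 + n2)%N; first by lia.
    move=> f; have -> : (n + 2 + n2 + f = n + (n2 + f).+2)%N by lia.
    rewrite en /= ha /= hb /= v1 h2 addn1 {1 2}/upd eqxx eq_sym v1N h1.
    have -> : (i.+1 < M)%N by lia.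
    exact: en2.
have [|//||m2 I2 e2] := loop M.-1 0%N (m.1, upd m.2 v 0%N); first by lia.
  by rewrite /= /upd eqxx.
exists m2; first exact: IQ.
move=> P k /= /code_at_cons[ha hc]; have [n ln en] := e2 P k hc.
exists n.+1; first by have := ln; rewrite prednK //; lia.
by move=> f; rewrite addSn /= ha /=; exact: en.
Qed.

End Wp.

(** * Expressions and their compilation *)

(** Real registers below this index are temporaries of expression evaluation; heap word [j] lives in
    register [heap_base + j]. *)
Definition heap_base : nat := 16.

(* Register indices are absolute; [NMulM e] is [min(e, M) * M] with [M = N[1]]. *)
Inductive nexp : Type :=
| NV of nat
| NK of nat
| NAd of nexp & nexp
| NMulM of nexp.

Inductive rop := OpAdd | OpSub | OpDiv.

(* [RFold b e0 e] folds addition (or minimum, if [b]) over the values of [e],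
   starting from [e0]; its loop variable is the first free register. *)
Inductive rexp : Type :=
| RK of rat
| RLd of nexp
| ROp of rop & rexp & rexp
| RIfR of rexp & rexp & rexp & rexp
| RIfN of nexp & nexp & rexp & rexp
| RFold of bool & rexp & rexp.

Inductive cmd : Type :=
| CStore of nexp & rexp
| CSeq of cmd & cmd
| CFor of cmd.

Fixpoint evaln (env : nat -> nat) (e : nexp) : nat :=
  match e with
  | NV i => env i
  | NK c => c
  | NAd a b => evaln env a + evaln env b
  | NMulM a => minn (evaln env a) (env 1) * env 1
  end.

Definition opsem (R : realType) (o : rop) (x y : R) : R :=
  match o with OpAdd => x + y | OpSub => x - y | OpDiv => x / y end.

Definition foldop (R : realType) (b : bool) (x y : R) : R :=
  if b then (if y < x then y else x) else x + y.

Fixpoint evalr (R : realType) (d : nat) (env : nat -> nat) (h : nat -> R) (e : rexp) : R :=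
  match e with
  | RK q => ratr q
  | RLd a => h (evaln env a)
  | ROp o a b => opsem o (evalr d env h a) (evalr d env h b)
  | RIfR a b e1 e2 => if evalr d env h a < evalr d env h b
                      then evalr d env h e1 else evalr d env h e2
  | RIfN a b e1 e2 => if (evaln env a < evaln env b)%N
                      then evalr d env h e1 else evalr d env h e2
  | RFold b e0 e1 =>
      foldl (fun x i => foldop b x (evalr d.+1 (upd env d i) h e1))
            (evalr d env h e0) (iota 0 (env 1))
  end.

Fixpoint csem (R : realType) (d : nat) (env : nat -> nat) (c : cmd) (h : nat -> R) : nat -> R :=
  match c with
  | CStore a e => upd h (evaln env a) (evalr d env h e)
  | CSeq c1 c2 => csem d env c2 (csem d env c1 h)
  | CFor c1 => foldl (fun h' i => csem d.+1 (upd env d i) c1 h') h (iota 0 (env 1))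
  end.

Fixpoint wfn (d : nat) (e : nexp) : bool :=
  match e with
  | NV i => (i < d)%N
  | NK _ => true
  | NAd a b => wfn d a && wfn d b
  | NMulM a => wfn d a
  end.

(** [r] is the register that receives the value. Temporaries grow upwards from it like a stack, and
    the bound at every node keeps them out of the heap. *)
Fixpoint wfr (d r : nat) (e : rexp) : bool :=
  (r < heap_base)%N &&
  match e with
  | RK _ => true
  | RLd a => wfn d a
  | ROp _ a b => wfr d r a && wfr d r.+1 b
  | RIfR a b e1 e2 => [&& wfr d r a, wfr d r.+1 b, wfr d r e1 & wfr d r e2]
  | RIfN a b e1 e2 => [&& wfn d a, wfn d b, wfr d r e1 & wfr d r e2]
  | RFold _ e0 e1 => wfr d r e0 && wfr d.+1 r.+1 e1
  end.

Fixpoint wfc (d : nat) (c : cmd) : bool :=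
  match c with
  | CStore a e => wfn d a && wfr d 0 e
  | CSeq c1 c2 => wfc d c1 && wfc d c2
  | CFor c1 => wfc d.+1 c1
  end.

(** The value goes to register [d], with scratch space above. Naturals have no multiplication
    instruction, so [NMulM] adds [N[1]] in those of the [M] rounds whose index is below the operand;
    this is where the minimum comes from. The other branch is idle: it writes to a scratch
    register. *)
Fixpoint compn (d : nat) (e : nexp) : stmt :=
  match e with
  | NV i => SSeq (SI (NConst d 0)) (SI (NAdd d d i))
  | NK c => SI (NConst d c)
  | NAd a b => SSeq (compn d a) (SSeq (compn d.+1 b) (SI (NAdd d d d.+1)))
  | NMulM a =>
      SSeq (compn d.+1 a) (SSeq (SI (NConst d 0))
        (SFor d.+2 (SIfN d.+2 d.+1 (SI (NAdd d d 1)) (SI (NConst d.+3 0)))))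
  end.

Definition opinstr (o : rop) (d a b : nat) : instr :=
  match o with OpAdd => RAdd d a b | OpSub => RSub d a b | OpDiv => RDiv d a b end.

(** For a minimum, the smaller value is moved by adding it to a zeroed register; the write to the
    nat register [d] is an idle else branch. *)
Definition foldstmt (b : bool) (d r : nat) : stmt :=
  if b then SIfR r.+1 r (SSeq (SI (RConst r 0)) (SI (RAdd r r r.+1))) (SI (NConst d 0))
  else SI (RAdd r r r.+1).

Definition comp_addr (d : nat) (a : nexp) : stmt := compn d (NAd (NK heap_base) a).

Fixpoint compr (d r : nat) (e : rexp) : stmt :=
  match e with
  | RK q => SI (RConst r q)
  | RLd a => SSeq (comp_addr d a) (SI (RLoad r d))
  | ROp o a b => SSeq (compr d r a) (SSeq (compr d r.+1 b) (SI (opinstr o r r r.+1)))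
  | RIfR a b e1 e2 =>
      SSeq (compr d r a) (SSeq (compr d r.+1 b) (SIfR r r.+1 (compr d r e1) (compr d r e2)))
  | RIfN a b e1 e2 =>
      SSeq (compn d a) (SSeq (compn d.+1 b) (SIfN d d.+1 (compr d r e1) (compr d r e2)))
  | RFold b e0 e1 =>
      SSeq (compr d r e0) (SFor d (SSeq (compr d.+1 r.+1 e1) (foldstmt b d.+1 r)))
  end.

Fixpoint compc (d : nat) (c : cmd) : stmt :=
  match c with
  | CStore a e => SSeq (compr d 0 e) (SSeq (comp_addr d a) (SI (RStore d 0)))
  | CSeq c1 c2 => SSeq (compc d c1) (compc d c2)
  | CFor c1 => SFor d (compc d.+1 c1)
  end.

(** * Correctness of the compiler *)

Section CompilerCorrectness.
Variables (R : realType) (M : nat).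
Hypothesis M_gt0 : (0 < M)%N.
Implicit Types (m : memory R) (h : nat -> R).

Definition env_ok (d : nat) (env : nat -> nat) (n : nat -> nat) :=
  [/\ (2 < d)%N, env 1%N = M, env 2%N = 1%N & forall i, (i < d)%N -> n i = env i].

Lemma env_ok_upd d env n i : env_ok d env n -> n d = i -> env_ok d.+1 (upd env d i) n.
Proof.
case=> d2 e1 e2 e ni; split; rewrite /upd ?ltn_eqF //; try lia.
move=> j; rewrite ltnS leq_eqVlt => /orP[/eqP->|jd]; first by rewrite eqxx.
by rewrite ltn_eqF // e.
Qed.

Lemma env_ok_ext d d' env n n' : (d <= d')%N -> (forall i, (i < d')%N -> n' i = n i) ->
  env_ok d env n -> env_ok d env n'.
Proof. by move=> dd h [? ? ? e]; split => // i id; rewrite h ?e //; lia. Qed.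

Lemma wfn_weaken e d : wfn d e -> wfn d.+1 e.
Proof. by elim: e d => //= [i d|a ha b hb d /andP[/ha-> /hb->]] //; exact: leqW. Qed.

(** Variables lie below [d], but scratch space may start at any [d'] from [d] on: the second operand
    of a sum is compiled above the value of the first. *)
Lemma compnP e d env m : env_ok d env m.2 -> wfn d e ->
  forall d', (d <= d')%N ->
  wp M (compn d' e) m (fun m' => [/\ m'.1 = m.1, forall i, (i < d')%N -> m'.2 i = m.2 i
                                  & m'.2 d' = evaln env e]).
Proof.
elim: e m => /= [i|c|a ha b hb|a ha] m ok wf d' dd'; have [d2 e1 e2 e] := ok.
- apply: wp_seq; apply: wp_instr => //; apply: wp_instr => //; split=> //=.
    by move=> j jd; rewrite /upd ltn_eqF // ltn_eqF.
  by rewrite /upd eqxx add0n ltn_eqF ?e //; lia.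
- apply: wp_instr => //; split=> //=; last by rewrite /upd eqxx.
  by move=> j jd; rewrite /upd ltn_eqF.
- case/andP: wf => wa wb; apply: wp_seq; apply: wp_mono (ha m ok wa d' dd').
  move=> m1 [r1 n1 v1]; apply: wp_seq.
  have ok1 : env_ok d env m1.2 by apply: env_ok_ext dd' n1 ok.
  apply: wp_mono (hb m1 ok1 wb d'.+1 (leqW dd')) => m2 [r2 n2 v2].
  apply: wp_instr => //; split=> /=; first by rewrite r2.
    by move=> j jd; rewrite /upd ltn_eqF // n2 ?n1 //; lia.
  by rewrite /upd eqxx v2 n2 // v1.
- apply: wp_seq; apply: wp_mono (ha m ok wf d'.+1 (leqW dd')) => m1 [r1 n1 v1].
  apply: wp_seq; apply: wp_instr => //=; rewrite /effect /=.
  pose I i (m' : memory R) := [/\ m'.1 = m.1, forall i, (i < d')%N -> m'.2 i = m.2 i,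
     m'.2 d'.+1 = evaln env a & m'.2 d' = (minn i (evaln env a) * M)%N].
  apply: (@wp_for _ _ I) => //.
  + split=> //=; rewrite /upd.
    * by move=> j jd; rewrite !ltn_eqF //; [rewrite n1 //|]; lia.
    * by rewrite ltn_eqF // gtn_eqF.
    * by rewrite min0n ltn_eqF // eqxx.
  + move=> i m2 iM [r2 n2 w2 x2] v2; have d1 : (1 < d')%N by lia.
    apply: wp_ifN => hlt; apply: wp_instr => //=; rewrite /upd; split => //=.
    * by rewrite gtn_eqF.
    * by rewrite ltn_eqF ?n2 ?e //; lia.
    * by rewrite ltn_eqF ?n2 ?e //; lia.
    * split=> //=.
      - by move=> j jd; rewrite !ltn_eqF ?n2 //; lia.
      - by rewrite ltn_eqF // gtn_eqF.
      - rewrite ltn_eqF // eqxx x2 n2 ?e ?e1 //; last by lia.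
        by move: hlt; rewrite v2 w2 => hlt; rewrite /minn hlt; case: ltnP; nia.
    * by rewrite ltn_eqF.
    * by rewrite n2 ?e //; lia.
    * by rewrite n2 ?e //; lia.
    * split=> //=.
      - by move=> j jd; rewrite !ltn_eqF ?n2 //; lia.
      - by rewrite !ltn_eqF.
      - rewrite !ltn_eqF ?x2 //; last by lia.
        by move: hlt; rewrite v2 w2 => hlt; congr muln; rewrite /minn; do 2!case: ltnP; lia.
  + by move=> m2 [r2 n2 w2 x2]; split => //; rewrite x2 e1 minnC.
Qed.

Lemma comp_addrP a d env m : env_ok d env m.2 -> wfn d a ->
  wp M (comp_addr d a) m
    (fun m' => [/\ m'.1 = m.1, forall i, (i < d)%N -> m'.2 i = m.2 i
                & m'.2 d = (heap_base + evaln env a)%N]).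
Proof. by move=> ok wf; exact: (compnP (e := NAd (NK heap_base) a) ok). Qed.

Definition heap_ok (h : nat -> R) (r : nat -> R) := forall j, r (heap_base + j)%N = h j.

Lemma heap_ok_upd h r i v : (i < heap_base)%N -> heap_ok h r -> heap_ok h (upd r i v).
Proof. by move=> ih e j; rewrite /upd gtn_eqF ?e //; lia. Qed.

Lemma comprP e d r env h m : env_ok d env m.2 -> heap_ok h m.1 -> wfr d r e ->
  wp M (compr d r e) m
    (fun m' => [/\ heap_ok h m'.1, forall i, (i < d)%N -> m'.2 i = m.2 i,
                   forall i, (i < r)%N -> m'.1 i = m.1 i
                & m'.1 r = evalr d env h e]).
Proof.
elim: e d r env m => /= [q|a|o a ha b hb|a ha b hb e1 h1 e2 h2|a b e1 h1 e2 h2|k e0 h0 e1 h1]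
  d r env m ok hok /andP[rh wf].
- apply: wp_instr => //; split=> //=; first exact: heap_ok_upd.
    by move=> i ir; rewrite /upd ltn_eqF.
  by rewrite /upd eqxx.
- apply: wp_seq; apply: wp_mono (comp_addrP ok wf) => m1 [r1 n1 v1].
  apply: wp_instr => //; split=> //=; rewrite ?r1; first exact: heap_ok_upd.
    by move=> i ir; rewrite /upd ltn_eqF.
  by rewrite /upd eqxx v1 hok.
- case/andP: wf => wa wb; apply: wp_seq; apply: wp_mono (ha d r env m ok hok wa).
  move=> m1 [k1 n1 q1 v1]; have ok1 := env_ok_ext (leqnn d) n1 ok.
  apply: wp_seq; apply: wp_mono (hb d r.+1 env m1 ok1 k1 wb) => m2 [k2 n2 q2 v2].
  apply: wp_instr; first by case: (o).
  split=> /=.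
  + by case: (o); apply: heap_ok_upd.
  + by move=> i id; rewrite -n1 // -n2 //; case: (o).
  + by move=> i ir; case: (o); rewrite /= /upd ltn_eqF // q2 ?q1 //; lia.
  + by case: (o); rewrite /= /upd eqxx v2 q2 // v1.
- case/and4P: wf => wa wb w1 w2; apply: wp_seq; apply: wp_mono (ha d r env m ok hok wa).
  move=> m1 [k1 n1 q1 v1]; have ok1 := env_ok_ext (leqnn d) n1 ok.
  apply: wp_seq; apply: wp_mono (hb d r.+1 env m1 ok1 k1 wb) => m2 [k2 n2 q2 v2].
  have ok2 := env_ok_ext (leqnn d) n2 ok1.
  have fin m' : (forall i, (i < d)%N -> m'.2 i = m2.2 i) ->
    (forall i, (i < r)%N -> m'.1 i = m2.1 i) ->
    (forall i, (i < d)%N -> m'.2 i = m.2 i) /\ (forall i, (i < r)%N -> m'.1 i = m.1 i).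
    by move=> A B; split=> i il; rewrite ?A ?B ?n2 ?n1 ?q2 ?q1 //; lia.
  apply: wp_ifR; rewrite v2 q2 // v1 => hlt.
    apply: wp_mono (h1 d r env m2 ok2 k2 w1) => m3 [k3 n3 q3 v3].
    by have [A B] := fin m3 n3 q3; split => //; rewrite hlt.
  apply: wp_mono (h2 d r env m2 ok2 k2 w2) => m3 [k3 n3 q3 v3].
  by have [A B] := fin m3 n3 q3; split => //; rewrite (negbTE hlt).
- case/and4P: wf => wa wb w1 w2; apply: wp_seq; apply: wp_mono (compnP ok wa (leqnn d)).
  move=> m1 [q1 n1 v1]; have ok1 := env_ok_ext (leqnn d) n1 ok.
  apply: wp_seq; apply: wp_mono (compnP ok1 wb (leqW (leqnn d))) => m2 [q2 n2 v2].
  have ok2 := env_ok_ext (leqW (leqnn d)) n2 ok1.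
  have hok2 : heap_ok h m2.1 by rewrite q2 q1.
  have fin m' : (forall i, (i < d)%N -> m'.2 i = m2.2 i) ->
    (forall i, (i < r)%N -> m'.1 i = m2.1 i) ->
    (forall i, (i < d)%N -> m'.2 i = m.2 i) /\ (forall i, (i < r)%N -> m'.1 i = m.1 i).
    by move=> A B; split=> i il; rewrite ?A ?B ?n2 ?n1 ?q2 ?q1 //; lia.
  apply: wp_ifN; rewrite v2 n2 // v1 => hlt.
    apply: wp_mono (h1 d r env m2 ok2 hok2 w1) => m3 [k3 n3 q3 v3].
    by have [A B] := fin m3 n3 q3; split => //; rewrite hlt.
  apply: wp_mono (h2 d r env m2 ok2 hok2 w2) => m3 [k3 n3 q3 v3].
  by have [A B] := fin m3 n3 q3; split => //; rewrite (negbTE hlt).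
- case/andP: wf => w0 w1; apply: wp_seq; apply: wp_mono (h0 d r env m ok hok w0).
  move=> m1 [k1 n1 q1 v1]; have [d2 E1 E2 E] := ok.
  pose F := fun x i => foldop k x (evalr d.+1 (upd env d i) h e1).
  (* The accumulator [r] holds the fold over the first [i] values; the body computes in registers
     above [r]. *)
  pose I i (m' : memory R) := [/\ heap_ok h m'.1, forall i, (i < d)%N -> m'.2 i = m.2 i,
                   forall i, (i < r)%N -> m'.1 i = m.1 i
                & m'.1 r = foldl F (evalr d env h e0) (iota 0 i)].
  apply: (@wp_for _ _ I) => //.
  + by split=> //= i id; rewrite /upd ltn_eqF // n1.
  + move=> i m2 iM [k2 n2 q2 v2] vi; have ok2 := env_ok_upd (env_ok_ext (leqnn d) n2 ok) vi.
    apply: wp_seq; apply: wp_mono (h1 d.+1 r.+1 _ m2 ok2 k2 w1) => m3 [k3 n3 q3 v3].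
    have nd1 : (d == 1)%N = false by lia.
    have keep n : (forall i, (i < d.+1)%N -> n i = m3.2 i) ->
       [/\ n d = i, n 2%N = 1%N, n 1%N = M & forall j, (j < d)%N -> upd n d i.+1 j = m.2 j].
      move=> hn; split; first (by rewrite hn ?n3); try by rewrite hn ?n3 ?n2 ?E //; lia.
      by move=> j jd; rewrite /upd ltn_eqF // hn ?n3 ?n2 //; lia.
    have v3r : m3.1 r = foldl F (evalr d env h e0) (iota 0 i) by rewrite q3 ?v2.
    have low j : (j < r)%N -> m3.1 j = m.1 j by move=> jr; rewrite q3 ?q2 //; lia.
    have Fi : foldl F (evalr d env h e0) (iota 0 i.+1) = foldop k (m3.1 r) (m3.1 r.+1).
      by rewrite -addn1 iotaD foldl_cat /= v3 -v3r.
    (* Common end of both kinds of fold: it remains to update [r] while sparing the heap, the lower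
       real registers and the nat registers up to [d]. *)
    have fin r' n' : (forall i, (i < d.+1)%N -> n' i = m3.2 i) -> heap_ok h r' ->
        (forall i, (i < r)%N -> r' i = m3.1 i) -> r' r = foldop k (m3.1 r) (m3.1 r.+1) ->
        [/\ n' d = i, n' 2%N = 1%N, d == 1%N = false, n' 1%N = M
          & I i.+1 (r', upd n' d i.+1)].
      move=> /keep[? ? ? ?] ? hr ?; split => //; split; rewrite ?Fi //.
      by move=> j jr /=; rewrite hr // low.
    rewrite /foldstmt; move: fin; rewrite /foldop; case: (k) => fin.
    * apply: wp_ifR => hlt.
      - apply: wp_seq; apply: wp_instr => //; apply: wp_instr => //; apply: fin => //=.
        + by do 2!apply: heap_ok_upd => //.
        + by move=> j jr; rewrite /upd ltn_eqF.
        + by rewrite /upd eqxx hlt gtn_eqF // rmorph0 add0r.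
      - apply: wp_instr => //; apply: fin => //=.
        + by move=> j jd; rewrite /upd ltn_eqF.
        + by rewrite (negbTE hlt).
    * apply: wp_instr => //; apply: fin => //=.
      + exact: heap_ok_upd.
      + by move=> j jr; rewrite /upd ltn_eqF.
      + by rewrite /upd eqxx.
  + by move=> m2 [k2 n2 q2 v2]; split=> //; rewrite v2 E1.
Qed.

Lemma compcP c d env h m : env_ok d env m.2 -> heap_ok h m.1 -> wfc d c ->
  wp M (compc d c) m
    (fun m' => heap_ok (csem d env c h) m'.1 /\ forall i, (i < d)%N -> m'.2 i = m.2 i).
Proof.
elim: c d env h m => /= [a e|c1 h1 c2 h2|c1 h1] d env h m ok hok wf.
- case/andP: wf => wa we; apply: wp_seq; apply: wp_mono (comprP ok hok we).
  move=> m1 [k1 n1 _ v1]; have ok1 := env_ok_ext (leqnn d) n1 ok.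
  apply: wp_seq; apply: wp_mono (comp_addrP ok1 wa) => m2 [r2 n2 v2].
  apply: wp_instr => //; split=> /=; last by move=> i id; rewrite n2 ?n1.
  by move=> j; rewrite /upd v2 eqn_add2l r2 v1 k1.
- case/andP: wf => w1 w2; apply: wp_seq; apply: wp_mono (h1 _ _ _ _ ok hok w1).
  move=> m1 [k1 n1]; apply: wp_mono (h2 _ _ _ _ (env_ok_ext (leqnn d) n1 ok) k1 w2).
  by move=> m2 [k2 n2]; split=> // i id; rewrite n2 ?n1.
- have [d2 E1 E2 E] := ok.
  pose F := fun h' i => csem d.+1 (upd env d i) c1 h'.
  pose I i (m' : memory R) := heap_ok (foldl F h (iota 0 i)) m'.1 /\
     forall i, (i < d)%N -> m'.2 i = m.2 i.
  apply: (@wp_for _ _ I) => //.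
  + by split=> //= i id; rewrite /upd ltn_eqF.
  + move=> i m2 iM [k2 n2] vi; have ok2 := env_ok_upd (env_ok_ext (leqnn d) n2 ok) vi.
    apply: wp_mono (h1 _ _ _ _ ok2 k2 wf) => m3 [k3 n3].
    split; first (by rewrite n3); try by rewrite ?n3 ?n2 ?E //; lia.
    split; last by move=> j jd; rewrite /= /upd ltn_eqF // n3 ?n2 //; lia.
    by rewrite -addn1 iotaD foldl_cat.
  + by move=> m2 [k2 n2]; rewrite E1.
Qed.

End CompilerCorrectness.

(** * The dynamic program as a RAM program *)

(* Nat registers 0, 1, 2 hold [T], [T + 1], [1]. The input word sits in the heap
   at offset [2 (T + 1)], the table of the dynamic program behind it. *)
Definition addr_p (t : nat) : nexp := NAd (NAd (NV 1) (NV 1)) (NV t).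
Definition addr_x (t : nat) : nexp := NAd (NAd (NAd (NV 1) (NV 1)) (NV 0)) (NV t).
Definition grid_idx (a b : nat) : nexp := NAd (NMulM (NV a)) (NV b).
Definition addr_G (a b : nat) : nexp :=
  NAd (NAd (NAd (NAd (NV 1) (NV 1)) (NAd (NV 1) (NV 1))) (NK heap_base)) (grid_idx a b).

(** No instruction converts a natural to a real, so the loop indices below [e] are counted; this is
    exact for values up to the number of rounds. *)
Definition nat_exp (d : nat) (e : nexp) : rexp :=
  RFold false (RK 0) (RIfN (NV d) e (RK 1) (RK 0)).

(** The loop has [T + 1] rounds; the guard discards the last index, [T]. *)
Definition sum_exp (d : nat) (e : rexp) : rexp :=
  RFold false (RK 0) (RIfN (NV d) (NV 0) e (RK 0)).

(** Equality of outcomes and of predictions is tested by two strict comparisons, so that the nested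
    cases spell out [before]. *)
Definition rank_exp (d t : nat) : rexp :=
  sum_exp d
    (RIfR (RLd (addr_x d)) (RLd (addr_x t)) (RK 0)
    (RIfR (RLd (addr_x t)) (RLd (addr_x d)) (RK 0)
    (RIfR (RLd (addr_p d)) (RLd (addr_p t)) (RK 1)
    (RIfR (RLd (addr_p t)) (RLd (addr_p d)) (RK 0)
    (RIfN (NV d) (NV t) (RK 1) (RK 0)))))).

Definition val_exp (d : nat) (a' b' a b : nexp) : rexp :=
  ROp OpDiv (ROp OpSub (nat_exp d b) (nat_exp d b'))
    (ROp OpAdd (ROp OpSub (nat_exp d a) (nat_exp d a'))
               (ROp OpSub (nat_exp d b) (nat_exp d b'))).

Definition in_range_exp (d t : nat) (lo hi : nexp) (e : rexp) : rexp :=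
  RIfR (rank_exp d t) (nat_exp d lo) (RK 0) (RIfR (rank_exp d t) (nat_exp d hi) e (RK 0)).

Definition dist_exp (u v : rexp) : rexp := RIfR u v (ROp OpSub v u) (ROp OpSub u v).

Definition err_exp (d t : nat) (a' b' a b : nexp) : rexp :=
  dist_exp (RLd (addr_p t)) (val_exp d a' b' a b).

Definition cost_exp (d : nat) (a' b' a b : nexp) : rexp :=
  sum_exp d (RIfR (RK 0) (RLd (addr_x d))
    (in_range_exp d.+1 d b' b (err_exp d.+1 d a' b' a b))
    (in_range_exp d.+1 d a' a (err_exp d.+1 d a' b' a b))).

Definition base_exp (d : nat) : rexp := cost_exp d (NK 0) (NK 0) (NV 3) (NV 4).

(** Registers 3 and 4 hold the current grid point, 5 and 6 a candidate predecessor. A candidate that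
    is not a predecessor yields the base cost, with which the minimum starts anyway. Among points
    not exceeding the current one in either coordinate, the comparison of grid indices excludes only
    the current one. *)
Definition step_exp : rexp :=
  RFold true (base_exp 5) (RFold true (base_exp 6)
    (RIfN (NV 3) (NV 5) (base_exp 7) (RIfN (NV 4) (NV 6) (base_exp 7)
      (RIfN (grid_idx 5 6) (grid_idx 3 4)
        (ROp OpAdd (RLd (addr_G 5 6)) (cost_exp 7 (NV 5) (NV 6) (NV 3) (NV 4)))
        (base_exp 7))))).

Definition fill_cmd : cmd := CFor (CFor (CStore (addr_G 3 4) step_exp)).

(** Heap word [j] initially is input word [heap_base + j]. With [M = N[1]] it goes to offset
    [2M + heap_base + j], right behind the low words saved by [move_low]; round [j] treats [j] and
    [M + j]. The targets lie beyond the [2M] source words, so no source is overwritten. *)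
Definition copy_cmd : cmd :=
  CFor (CSeq
    (CStore (NAd (NAd (NAd (NV 1) (NV 1)) (NK heap_base)) (NV 3)) (RLd (NV 3)))
    (CStore (NAd (NAd (NAd (NV 1) (NV 1)) (NK heap_base)) (NAd (NV 1) (NV 3)))
            (RLd (NAd (NV 1) (NV 3))))).

Definition eq_exp (u v e : rexp) : rexp := RIfR u v (RK 0) (RIfR v u (RK 0) e).

(** The numbers of zeros and ones are computed as reals and cannot serve as addresses, so the entry
    is selected by a sum over the whole grid in which only the matching point survives. *)
Definition ans_exp : rexp :=
  RFold false (RK 0) (RFold false (RK 0)
    (eq_exp (nat_exp 5 (NV 3)) (sum_exp 5 (RIfR (RK 0) (RLd (addr_x 5)) (RK 0) (RK 1)))
    (eq_exp (nat_exp 5 (NV 4)) (sum_exp 5 (RIfR (RK 0) (RLd (addr_x 5)) (RK 1) (RK 0)))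
      (RLd (addr_G 3 4))))).

(* The low real registers are needed as temporaries, so the input stored there
   is moved out first, one instruction sequence per register. *)
Fixpoint move_low (n : nat) : stmt :=
  if n is n'.+1 then
    SSeq (move_low n') (SSeq (SI (NConst 3 (heap_base + n'))) (SSeq (SI (NAdd 3 3 1))
      (SSeq (SI (NAdd 3 3 1)) (SI (RStore 3 n')))))
  else SI (NConst 3 0).

Definition caldist_stmt : stmt :=
  SSeq (SI (NConst 2 1)) (SSeq (SI (NAdd 1 0 2)) (SSeq (move_low heap_base)
    (SSeq (compc 3 (CSeq copy_cmd fill_cmd)) (compr 3 0 ans_exp)))).

(** * Semantics of the expressions *)

Lemma foldl_iota (S : Type) (I : nat -> S -> Prop) (F : S -> nat -> S) s0 n :
  I 0%N s0 -> (forall i s, (i < n)%N -> I i s -> I i.+1 (F s i)) ->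
  I n (foldl F s0 (iota 0 n)).
Proof.
move=> I0 IS; suff H k : (k <= n)%N -> I k (foldl F s0 (iota 0 k)) by exact: H.
elim: k => // k IH kn; rewrite -addn1 iotaD foldl_cat /= addn1.
by apply: IS => //; apply: IH; exact: ltnW.
Qed.

Lemma eq_foldl_iota (S : Type) (F F' : S -> nat -> S) s0 n :
  (forall s i, (i < n)%N -> F s i = F' s i) ->
  foldl F s0 (iota 0 n) = foldl F' s0 (iota 0 n).
Proof.
move=> FF'; apply: (@foldl_iota _ (fun k s => s = foldl F' s0 (iota 0 k))) => // i s iN ->.
by rewrite -[in RHS]addn1 iotaD foldl_cat /= FF'.
Qed.

Section Semantics.
Variables (R : realType).
Implicit Types (env : nat -> nat) (h : nat -> R).

Lemma foldl_add (f : nat -> R) n :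
  foldl (fun y i => foldop false y (f i)) 0 (iota 0 n) = \sum_(i < n) f i.
Proof.
apply: (@foldl_iota _ (fun n s => s = \sum_(i < n) f i)); first by rewrite big_ord0.
by move=> i s _ ->; rewrite big_ord_recr.
Qed.

Lemma evalr_fold_add d env h e :
  evalr d env h (RFold false (RK 0) e) = \sum_(i < env 1) evalr d.+1 (upd env d i) h e.
Proof. by rewrite /= rmorph0 foldl_add. Qed.

Lemma foldl_min (f : nat -> R) y0 n :
  let m := foldl (fun y i => foldop true y (f i)) y0 (iota 0 n) in
  [/\ m <= y0, forall i, (i < n)%N -> m <= f i
    & m = y0 \/ exists2 i, (i < n)%N & m = f i].
Proof.
apply: (@foldl_iota _ (fun n m => [/\ m <= y0, forall i, (i < n)%N -> m <= f i
    & m = y0 \/ exists2 i, (i < n)%N & m = f i])); first by split=> //; left.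
move=> i s _ [h1 h2 h3]; rewrite /foldop; case: (ltP (f i) s) => hs; split.
- exact: le_trans (ltW hs) h1.
- move=> j; rewrite ltnS leq_eqVlt => /orP[/eqP->//|/h2 js].
  exact: le_trans (ltW hs) js.
- by right; exists i.
- exact: h1.
- by move=> j; rewrite ltnS leq_eqVlt => /orP[/eqP->//|/h2 js].
- by case: h3 => [->|[j ji ->]]; [left|right; exists j => //; exact: leqW].
Qed.

Lemma evaln_upd d env i e : (1 < d)%N -> wfn d e -> evaln (upd env d i) e = evaln env e.
Proof.
move=> d1; elim: e => //= [j jd|a ha b hb /andP[/ha-> /hb->]//|a ha /ha->].
  by rewrite /upd ltn_eqF.
by rewrite /upd ltn_eqF.
Qed.

Variables (T : nat) (x : 'I_T -> bool) (p : 'I_T -> R).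
Let M := T.+1.

Definition env_std (d : nat) env := [/\ (2 < d)%N, env 0%N = T & env 1%N = M].

Lemma env_std_upd d env i : env_std d env -> env_std d.+1 (upd env d i).
Proof. by case=> h0 h1 h2; split; rewrite /upd ?ltn_eqF //; lia. Qed.

Lemma evalr_nat d env h e : env_std d env -> wfn d e -> (evaln env e <= M)%N ->
  evalr d env h (nat_exp d e) = (evaln env e)%:R.
Proof.
case=> d2 e0 e1 we le; rewrite /= rmorph0 rmorph1 foldl_add e1.
rewrite (eq_bigr (fun i : 'I_M => if (i < evaln env e)%N then 1 else 0)); last first.
  by move=> i _; rewrite evaln_upd // ?(ltnW d2) // /upd eqxx.
by rewrite -big_mkcond /= (big_ord_narrow le) sumr_const card_ord.
Qed.

Lemma evalr_sum d env h e : env_std d env ->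
  evalr d env h (sum_exp d e) = \sum_(t < T) evalr d.+1 (upd env d t) h e.
Proof.
case=> d2 e0 e1; rewrite /= rmorph0 foldl_add e1.
have u0 i : upd env d i 0%N = T by rewrite /upd ltn_eqF ?e0 //; lia.
have ud i : upd env d i d = i by rewrite /upd eqxx.
rewrite big_ord_recr /= u0 ud ltnn addr0.
by apply: eq_bigr => i _; rewrite u0 ud ltn_ord.
Qed.

Definition heap_input h := forall t : 'I_T,
  h (M + M + t)%N = p t /\ h (M + M + T + t)%N = (x t)%:R.

Lemma evalr_p d env h (t : 'I_T) i : env_std d env -> heap_input h -> env i = t ->
  h (evaln env (addr_p i)) = p t.
Proof. by case=> _ _ e1 hin ei; rewrite /= e1 ei; case: (hin t). Qed.

Lemma evalr_x d env h (t : 'I_T) i : env_std d env -> heap_input h -> env i = t ->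
  h (evaln env (addr_x i)) = (x t)%:R.
Proof. by case=> _ e0 e1 hin ei; rewrite /= e0 e1 ei; case: (hin t). Qed.

Lemma evalr_rank d env h (t : 'I_T) i : env_std d env -> heap_input h -> (i < d)%N ->
  env i = t -> evalr d env h (rank_exp d i) = (rk x p t)%:R.
Proof.
move=> st hin id ei; rewrite evalr_sum // /rk -sum1_card natr_sum [RHS]big_mkcond /=.
apply: eq_bigr => s _; have st' := env_std_upd s st.
have ei' : upd env d s i = t by rewrite /upd ltn_eqF.
have ed' : upd env d s d = s by rewrite /upd eqxx.
have := evalr_p st' hin ei'; have := evalr_p st' hin ed'.
have := evalr_x st' hin ei'; have := evalr_x st' hin ed'.
rewrite /= => -> -> -> ->; rewrite ei' ed' rmorph0 rmorph1 inE /before.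
case: (x s) (x t) => -[]; rewrite ?ltxx ?ltr01 ?ltr10 //=.
  by case: ltgtP => //= _; case: ltnP.
by case: ltgtP => //= _; case: ltnP.
Qed.

Lemma evalr_cost d env h a' b' a b : env_std d env -> heap_input h ->
  all (wfn d) [:: a'; b'; a; b] -> all (fun e => evaln env e <= T)%N [:: a'; b'; a; b] ->
  evalr d env h (cost_exp d a' b' a b)
  = blockcost x p (evaln env a') (evaln env b') (evaln env a) (evaln env b).
Proof.
move=> st hin ww ll; have /and5P[wa' wb' wa wb _] := ww.
have /and5P[la' lb' la lb _] := ll.
rewrite /cost_exp evalr_sum // /blockcost [RHS]big_mkcond.
apply: eq_bigr => t _; have st' := env_std_upd t st; have [d2 _ _] := st.
have ed' : upd env d t d = t by rewrite /upd eqxx.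
have d1 : (1 < d)%N by lia.
have N e : wfn d e -> (evaln env e <= T)%N ->
    evalr d.+1 (upd env d t) h (nat_exp d.+1 e) = (evaln env e)%:R.
  move=> we le; rewrite evalr_nat ?evaln_upd //; first exact: wfn_weaken.
  exact: leqW.
have hp := evalr_p st' hin ed'; have hx := evalr_x st' hin ed'.
have hr := evalr_rank st' hin (leqnn _) ed'.
have hv : evalr d.+1 (upd env d t) h (val_exp d.+1 a' b' a b)
    = blockval R (evaln env a') (evaln env b') (evaln env a) (evaln env b).
  move: (N a' wa' la') (N b' wb' lb') (N a wa la) (N b wb lb); rewrite /val_exp.
  move: (nat_exp _ a') (nat_exp _ b') (nat_exp _ a) (nat_exp _ b) => A' B' A B.
  by cbn [evalr opsem] => -> -> -> ->.
have hd : evalr d.+1 (upd env d t) h (err_exp d.+1 d a' b' a b)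
    = `|p t - blockval R (evaln env a') (evaln env b') (evaln env a) (evaln env b)|.
  rewrite /err_exp; move: hp hv; move: (addr_p d) (val_exp _ _ _ _ _) => P V /= -> ->.
  by case: ltP => hlt; [rewrite ltr0_norm ?subr_lt0 // opprB|rewrite ger0_norm ?subr_ge0].
have hrange lo hi : wfn d lo -> wfn d hi -> (evaln env lo <= T)%N -> (evaln env hi <= T)%N ->
  evalr d.+1 (upd env d t) h (in_range_exp d.+1 d lo hi
     (err_exp d.+1 d a' b' a b))
  = if ~~ (rk x p t < evaln env lo)%N && (rk x p t < evaln env hi)%N then
    `|p t - blockval R (evaln env a') (evaln env b') (evaln env a) (evaln env b)| else 0.
  move=> wl wh lo_le lh; move: hd hr (N lo wl lo_le) (N hi wh lh); rewrite /in_range_exp.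
  move: (err_exp _ _ _ _ _ _) (rank_exp _ _) (nat_exp _ lo) (nat_exp _ hi) => D K L H /=.
  by move=> -> -> -> ->; rewrite !ltr_nat rmorph0; case: ifP => //= _; case: ifP.
move: hx (hrange _ _ wa' wa la' la) (hrange _ _ wb' wb lb' lb).
move: (addr_x d) (in_range_exp _ _ a' _ _) (in_range_exp _ _ b' _ _) => X A B /= -> -> ->.
by rewrite rmorph0 inE; case: (x t); rewrite ?ltr01 ?ltxx.
Qed.

Definition table h (a b : nat) : R := h (M + M + (M + M) + heap_base + (a * M + b))%N.

Lemma evaln_idx env a b : env 1%N = M -> (env a <= T)%N ->
  evaln env (grid_idx a b) = (env a * M + env b)%N.
Proof. by move=> e1 la; rewrite /= e1 (minn_idPl _) // leqW. Qed.

Lemma evaln_addr_G env a b : env 1%N = M -> (env a <= T)%N ->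
  evaln env (addr_G a b) = (M + M + (M + M) + heap_base + (env a * M + env b))%N.
Proof. by move=> e1 la; rewrite -evaln_idx //= e1. Qed.

(** Rows have length [M] and columns stay below [M], so table indices are ordered
    lexicographically. *)
Lemma grid_lt a' b' a b : (b' <= T)%N -> (b <= T)%N -> (a' * M + b' < a * M + b)%N =
  (a' < a)%N || (a' == a) && (b' < b)%N.
Proof. by rewrite /M => h1 h2; case: (ltngtP a' a) => /= [h|h|->]; nia. Qed.

Lemma evalr_step env h a b : env_std 5 env -> heap_input h ->
  env 3%N = a -> env 4%N = b -> (a <= T)%N -> (b <= T)%N ->
  let v := evalr 5 env h step_exp in
  [/\ v <= blockcost x p 0 0 a b,
   forall a' b', (a' <= a)%N -> (b' <= b)%N -> (a', b') != (a, b) ->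
     v <= table h a' b' + blockcost x p a' b' a b
   & v = blockcost x p 0 0 a b \/
     exists a' b', [/\ (a' <= a)%N, (b' <= b)%N, (a', b') != (a, b)
                     & v = table h a' b' + blockcost x p a' b' a b]].
Proof.
move=> st hin e3 e4 la lb.
have base d env' : (4 < d)%N -> env_std d env' -> env' 3%N = a -> env' 4%N = b ->
    evalr d env' h (base_exp d) = blockcost x p 0 0 a b.
  move=> d4 st' e3' e4'; rewrite /base_exp evalr_cost //= ?e3' ?e4' ?la ?lb //.
  by rewrite !andbT; lia.
pose g a' b' := if [&& a' <= a, b' <= b & a' * M + b' < a * M + b]%N
  then table h a' b' + blockcost x p a' b' a b else blockcost x p 0 0 a b.
have inner a' b' : (a' <= T)%N -> (b' <= T)%N ->
  let env2 := upd (upd env 5 a') 6 b' in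
  evalr 7 env2 h (RIfN (NV 3) (NV 5) (base_exp 7) (RIfN (NV 4) (NV 6) (base_exp 7)
      (RIfN (grid_idx 5 6) (grid_idx 3 4)
        (ROp OpAdd (RLd (addr_G 5 6)) (cost_exp 7 (NV 5) (NV 6) (NV 3) (NV 4)))
        (base_exp 7)))) = g a' b'.
  move=> la' lb' env2; have st2 : env_std 7 env2 by do 2!apply: env_std_upd.
  have E3 : env2 3%N = a by [].
  have E4 : env2 4%N = b by [].
  have E5 : env2 5%N = a' by [].
  have E6 : env2 6%N = b' by [].
  have [_ _ E1] := st2.
  have := base 7%N env2 isT st2 E3 E4.
  have := @evalr_cost 7 env2 h (NV 5) (NV 6) (NV 3) (NV 4) st2 hin isT.
  have := @evaln_addr_G env2 5 6 E1; have := @evaln_idx env2 5 6 E1.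
  have := @evaln_idx env2 3 4 E1.
  move: (base_exp 7) (cost_exp 7 _ _ _ _) (addr_G 5 6) (grid_idx 5 6) (grid_idx 3 4).
  move=> B C A I1 I2; cbn [evalr evaln opsem all].
  rewrite E3 E4 E5 E6 la lb la' lb' => -> // -> // -> // -> // ->.
  by rewrite /g (ltnNge a a') (ltnNge b b'); case: (a' <= a)%N; case: (b' <= b)%N.
have gspec a' b' : (a' <= a)%N -> (b' <= b)%N -> (a', b') != (a, b) ->
    g a' b' = table h a' b' + blockcost x p a' b' a b.
  move=> ha hb ne; rewrite /g ha hb grid_lt //=; last by lia.
  by rewrite xpair_eqE in ne; case: ifP => // /negP[]; lia.
have [_ _ e1] := st.
pose f a' := foldl (fun y i => foldop true y (g a' i)) (blockcost x p 0 0 a b) (iota 0 M).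
have -> : evalr 5 env h step_exp =
   foldl (fun y i => foldop true y (f i)) (blockcost x p 0 0 a b) (iota 0 M).
  rewrite /step_exp; cbn [evalr]; rewrite (base 5%N) // e1.
  apply: eq_foldl_iota => y a' la'.
  have st1 : env_std 6 (upd env 5 a') := env_std_upd a' st; have [_ _ e11] := st1.
  congr foldop; rewrite (base 6%N _ isT st1 e3 e4) e11.
  apply: eq_foldl_iota => z b' lb'.
  by congr foldop; exact: inner.
cbv zeta; have [v0 vle vatt] := foldl_min f (blockcost x p 0 0 a b) M.
split=> //.
- move=> a' b' ha hb ne; rewrite -gspec //; apply: le_trans (vle a' _) _; first by rewrite ltnS; lia.
  by have [_ fle _] := foldl_min (g a') (blockcost x p 0 0 a b) M; apply: fle; rewrite ltnS; lia.
- case: vatt => [->|[a' ha' ->]]; first by left.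
  have [_ _] := foldl_min (g a') (blockcost x p 0 0 a b) M.
  rewrite -/(f a') => -[->|[b' hb' ->]]; first by left.
  rewrite /g; case: ifP => [/and3P[ha hb hlt]|_]; last by left.
  right; exists a', b'; split=> //; apply: contraTneq hlt => -[-> ->].
  by rewrite ltnn.
Qed.

Lemma csem_fill env h : env_std 3 env -> heap_input h ->
  let h' := csem 3 env fill_cmd h in
  heap_input h' /\ forall a b, (a <= T)%N -> (b <= T)%N -> bellman_at x p (table h') a b.
Proof.
move=> st hin.
(* The table is filled row by row: after [k] writes the equations hold at the points of index below
   [k], since each involves only its own and smaller indices. *)
pose J k (h' : nat -> R) := heap_input h' /\ forall a b, (a <= T)%N -> (b <= T)%N ->
  (a * M + b < k)%N -> bellman_at x p (table h') a b.
suff H : J (M * M)%N (csem 3 env fill_cmd h).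
  case: H => H1 H2; split=> // a b la lb; apply: H2 => //.
  by rewrite /M; nia.
have [_ _ e1] := st; rewrite /fill_cmd; cbn [csem]; rewrite e1.
apply: (@foldl_iota _ (fun k => J (k * M)%N)); first by split.
move=> a h1 aM J1; rewrite [upd env 3 a 1%N]e1 mulSn addnC.
apply: (@foldl_iota _ (fun k => J (a * M + k)%N)); first by rewrite addn0.
move=> b h2 bM [hin2 J2].
set env2 := upd (upd env 3 a) 4 b.
have st2 : env_std 5 env2 by do 2!apply: env_std_upd.
have [_ _ e21] := st2.
rewrite (evaln_addr_G _ e21) //.
have -> : env2 3%N = a by []. have -> : env2 4%N = b by [].
have := @evalr_step env2 h2 a b st2 hin2 erefl erefl aM bM.
set v := evalr 5 env2 h2 step_exp => -[v1 v2 v3].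
set h3 := upd h2 _ v.
have tnew : table h3 a b = v by rewrite /table /h3 /upd eqxx.
have told a' b' : (a' * M + b' < a * M + b)%N -> table h3 a' b' = table h2 a' b'.
  by move=> lt; rewrite /table /h3 /upd eqn_add2l ltn_eqF.
split.
  move=> t; have [A B] := hin2 t; have tT := ltn_ord t.
  by rewrite /h3 /upd !ltn_eqF // /M /heap_base; lia.
move=> a0 b0 la lb; rewrite addnS ltnS leq_eqVlt => /orP[/eqP e|lt].
(* Equal indices rule out both strict lexicographic comparisons. *)
- have [ea eb] : a0 = a /\ b0 = b.
    have := ltnn (a * M + b); rewrite -{1}e grid_lt //.
    have := ltnn (a * M + b); rewrite -{2}e grid_lt //; lia.
  rewrite {}ea {}eb; have old a' b' : (a' <= a)%N -> (b' <= b)%N -> (a', b') != (a, b) ->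
    table h3 a' b' = table h2 a' b'.
    by move=> ha hb ne; apply: told; rewrite grid_lt; rewrite ?xpair_eqE in ne *; lia.
  split; rewrite ?tnew //.
  + by move=> a' b' ha hb ne; rewrite old //; exact: v2.
  + case: v3 => [->|[a' [b' [ha hb ne ->]]]]; [by left|right].
    by exists a', b'; rewrite old.
(* An earlier point and all its predecessors have indices below that of the cell just written, so
   their equation persists. *)
- have [w1 w2 w3] := J2 _ _ la lb lt.
  have old a' b' : (a' <= a0)%N -> (b' <= b0)%N -> table h3 a' b' = table h2 a' b'.
    by move=> ha hb; apply: told; apply: leq_ltn_trans lt; apply: leq_add => //; rewrite leq_mul2r ha orbT.
  split; rewrite ?(old a0 b0) //.
  + by move=> a' b' ha hb ne; rewrite old //; exact: w2.
  + case: w3 => [->|[a' [b' [ha hb ne ->]]]]; [by left|right].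
    by exists a', b'; rewrite old.
Qed.

Lemma csem_copy env h (inp : nat -> R) : env_std 3 env ->
  (forall j, (j < M + M)%N -> h j = inp (heap_base + j)%N) ->
  (forall i, (i < heap_base)%N -> h (M + M + i)%N = inp i) ->
  forall i, (i < M + M + heap_base)%N -> csem 3 env copy_cmd h (M + M + i)%N = inp i.
Proof.
move=> st h1 h2; have [_ _ e1] := st.
pose J k (h' : nat -> R) := [/\ forall j, (j < M + M)%N -> h' j = inp (heap_base + j)%N,
  forall i, (i < heap_base)%N -> h' (M + M + i)%N = inp i &
  forall j, (j < k)%N -> h' (M + M + heap_base + j)%N = inp (heap_base + j)%N /\
                         h' (M + M + heap_base + (M + j))%N = inp (heap_base + (M + j))%N].
suff [H1 H2 H3] : J M (csem 3 env copy_cmd h).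
  move=> i iM; have [lt|le] := ltnP i heap_base; first exact: H2.
  have [lt2|le2] := ltnP (i - heap_base) M.
    have [A _] := H3 _ lt2.
    have E : (heap_base + (i - heap_base) = i)%N by lia.
    by rewrite -addnA E in A.
  have lt3 : (i - heap_base - M < M)%N by lia.
  have [_ A] := H3 _ lt3.
  have E : (heap_base + (M + (i - heap_base - M)) = i)%N by lia.
  by rewrite -addnA E in A.
rewrite /copy_cmd; cbn [csem]; rewrite e1.
apply: (@foldl_iota _ J); first by split.
move=> j h' jM [J1 J2 J3]; cbn [evaln evalr].
have -> : upd env 3 j 1%N = M by [].
have -> : upd env 3 j 3%N = j by [].
have jMM : (j < M + M)%N by lia.
split.
- by move=> i iM; rewrite /upd !ltn_eqF ?J1 //; lia.
- by move=> i iM; rewrite /upd !ltn_eqF ?J2 //; lia.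
- move=> i; rewrite ltnS => ij; rewrite /upd !eqn_add2l.
  have -> : (i == M + j)%N = false by lia.
  have -> : (M + i == j)%N = false by lia.
  have -> : (M + j == M + M + heap_base + j)%N = false by lia.
  case: eqP => [->|ne]; first by rewrite !J1 //; lia.
  by apply: J3; lia.
Qed.

Lemma evalr_ans env h : env_std 3 env -> heap_input h ->
  evalr 3 env h ans_exp = table h (cls x false setT) (cls x true setT).
Proof.
move=> st hin; have [_ _ e1] := st.
have cnt env2 c : env_std 5 env2 ->
    evalr 5 env2 h (sum_exp 5 (RIfR (RK 0) (RLd (addr_x 5)) (RK (~~ c)%:R) (RK c%:R)))
    = (cls x (~~ c) setT)%:R.
  move=> st2; rewrite evalr_sum // /cls -sum1_card natr_sum [RHS]big_mkcond /=.
  apply: eq_bigr => t _; have st' := env_std_upd t st2.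
  have ed' : upd env2 5 t 5 = t by [].
  have := evalr_x st' hin ed' => /= ->; rewrite !inE rmorph0 !rmorph_nat.
  by case: (x t); case: c; rewrite ?ltr01 ?ltxx.
have bodyE a b : (a <= T)%N -> (b <= T)%N -> let env2 := upd (upd env 3 a) 4 b in
  evalr 5 env2 h
    (eq_exp (nat_exp 5 (NV 3)) (sum_exp 5 (RIfR (RK 0) (RLd (addr_x 5)) (RK 0) (RK 1)))
    (eq_exp (nat_exp 5 (NV 4)) (sum_exp 5 (RIfR (RK 0) (RLd (addr_x 5)) (RK 1) (RK 0)))
      (RLd (addr_G 3 4)))) =
  if a == cls x false setT then if b == cls x true setT then table h a b else 0 else 0.
  move=> la lb env2; have st2 : env_std 5 env2 by do 2!apply: env_std_upd.
  have [_ _ E1] := st2.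
  have := @evalr_nat 5 env2 h (NV 3) st2 isT (leqW la).
  have := @evalr_nat 5 env2 h (NV 4) st2 isT (leqW lb).
  have := cnt env2 true st2; have := cnt env2 false st2.
  have := @evaln_addr_G env2 3 4 E1 la.
  move: (addr_G 3 4) (nat_exp 5 _) (nat_exp 5 _) (sum_exp 5 _) (sum_exp 5 _).
  move=> A N4 N3 S1 S0 hA hS1 hS0 h4 h3; rewrite /eq_exp; cbn [evalr].
  rewrite hA hS1 hS0 h4 h3 rmorph0 /= !ltr_nat.
  rewrite -[env2 3%N]/a -[env2 4%N]/b.
  by case: (ltngtP a) => //= ->; case: (ltngtP b) => //= ->.
rewrite /ans_exp evalr_fold_add e1.
(* Each of the two sums has at most one nonzero term; [inord] is faithful because class sizes are at
   most [T]. *)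
rewrite (eq_bigr (fun a : 'I_M => if a == inord (cls x false setT)
  then table h (cls x false setT) (cls x true setT) else 0)).
  by rewrite -big_mkcond big_pred1_eq.
move=> a _; rewrite evalr_fold_add [upd env 3 a 1%N]e1.
rewrite (eq_bigr (fun b : 'I_M => if b == inord (cls x true setT) then
   if a == inord (cls x false setT) then table h (cls x false setT) (cls x true setT) else 0 else 0)).
  by rewrite -big_mkcond big_pred1_eq.
move=> b _; rewrite (bodyE a b (ltn_ord a) (ltn_ord b)).
have E c (i : 'I_M) : (i == inord (cls x c setT)) = (i == cls x c setT :> nat).
  by rewrite -val_eqE /= inordK // ltnS cls_le.
rewrite !E; case: eqP => [->|_]; last by case: ifP.
by case: eqP => [->|].
Qed.

End Semantics.

(** * Assembling the program *)

Lemma wp_move_low (R : realType) (M n : nat) (m : memory R) : (0 < M)%N -> m.2 1%N = M ->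
  (n <= heap_base)%N ->
  wp M (move_low n) m (fun m' => [/\ forall i, (i < 3)%N -> m'.2 i = m.2 i,
    forall i, (i < heap_base + (M + M))%N -> m'.1 i = m.1 i
    & forall i, (i < n)%N -> m'.1 (heap_base + (M + M + i))%N = m.1 i]).
Proof.
(* The targets start at register [heap_base + 2M], past every register that the second clause
   protects, so moving one low word never destroys another. *)
move=> M0 m1; elim: n => [|n IH] nb /=.
  by apply: wp_instr => //; split=> // i i3; rewrite /= /upd ltn_eqF.
apply: wp_seq; apply: wp_mono (IH (ltnW nb)) => m2 [n2 lo hi].
do 3!(apply: wp_seq; apply: wp_instr => //); apply: wp_instr => //=.
rewrite /upd /= !n2 // m1.
have -> : (heap_base + n + M + M = heap_base + (M + M + n))%N by lia.
split=> [i i3|i il|i].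
- by rewrite ltn_eqF // n2.
- by rewrite ltn_eqF ?lo //; lia.
- rewrite ltnS leq_eqVlt !eqn_add2l => /orP[/eqP->|il]; last by rewrite ltn_eqF // hi.
  by rewrite eqxx lo //; lia.
Qed.

Lemma caldist_stmtP (R : realType) (T : nat) (x : 'I_T -> bool) (p : 'I_T -> R) :
  let s := init_state x p in
  wp T.+1 caldist_stmt (rmem s, nmem s) (fun m => m.1 0%N = CalDist x p).
Proof.
move=> s; set M := T.+1; pose inp := rmem s.
have inpP (t : 'I_T) : inp t = p t /\ inp (T + t)%N = (x t)%:R.
  rewrite /inp /=; split; first by rewrite valK.
  have -> : insub (T + t)%N = None :> option 'I_T by rewrite insubF //; lia.
  by rewrite addKn valK.
do 2!(apply: wp_seq; apply: wp_instr; first by []).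
apply: wp_seq; set m0 := effect _ _.
have m01 : m0.2 1%N = M by rewrite /m0 /= /upd /= addn1.
apply: wp_mono (wp_move_low (ltn0Sn T) m01 (leqnn _)) => m1 [n1 lo hi].
pose env (i : nat) := m1.2 i; pose h j := m1.1 (heap_base + j)%N.
have ok : env_ok M 3 env m1.2.
  by split=> //; rewrite /env n1.
have st : env_std T 3 env by split=> //; rewrite /env n1.
apply: wp_seq; apply: wp_mono (@compcP _ _ (ltn0Sn T) (CSeq copy_cmd fill_cmd) 3 env h m1 ok _ isT) => //.
move=> m2 [hok2 n2]; set hc := csem 3 env copy_cmd h.
have {}hok2 : heap_ok (csem 3 env fill_cmd hc) m2.1 by [].
have hin : heap_input x p hc.
  have H : forall i, (i < M + M + heap_base)%N -> hc (M + M + i)%N = inp i.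
    apply: csem_copy => // j hj; rewrite /h.
    by rewrite lo //; lia.
  move=> t; have [A B] := inpP t; have tT := ltn_ord t.
  by rewrite -(addnA (M + M)%N T) !H ?A ?B //; lia.
have [hin' bell] := csem_fill st hin.
have ok2 : env_ok M 3 env m2.2 by apply: env_ok_ext (leqnn _) n2 ok.
apply: wp_mono (comprP (ltn0Sn T) (e := ans_exp) (r := 0) ok2 hok2 isT) => m3 [_ _ _ ->].
by rewrite (evalr_ans st hin') (CalDist_dp bell).
Qed.

Theorem theorem1 :
  exists (P : program) (C c k : nat), (0 < C)%N /\
    forall (R : realType) (T : nat) (x : 'I_T -> bool) (p : 'I_T -> R),
      (0 < T)%N ->
      (forall t, 0 <= p t <= 1) ->
      exists v : R,
        run P (c * T ^ k)%N (init_state x p) = Some v /\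
        `|v - CalDist x p| <= C%:R * Num.sqrt (T%:R).
Proof.
have [c [k ck]] := stime_poly caldist_stmt.
(* The output is exact, so [C = 1] serves. From [T + 1 <= 2T] the bound [c (T + 1)^k] becomes
   [c 2^k T^k]; the summand 1 pays for the last unit of fuel, in which [run] finds the end of the
   program. *)
exists (scode 0 caldist_stmt), 1%N, (c * 2 ^ k + 1)%N, k; split=> // R T x p T0 _.
have [m hm hrun] := caldist_stmtP x p.
exists (CalDist x p); split; last by rewrite subrr normr0 mul1r sqrtr_ge0.
have [n ln en] := hrun _ _ (code_at_self _).
have tb : (n.+1 <= (c * 2 ^ k + 1) * T ^ k)%N.
  have h1 := ck T.+1 (ltn0Sn T).
  have h2 : (T.+1 ^ k <= 2 ^ k * T ^ k)%N by rewrite -expnMn; case: (k) => [|j] //; rewrite leq_exp2r //; lia.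
  have h3 : (0 < T ^ k)%N by rewrite expn_gt0 T0.
  have h4 : (c * T.+1 ^ k <= c * (2 ^ k * T ^ k))%N by rewrite leq_mul2l h2 orbT.
  by rewrite mulnDl mul1n -mulnA; lia.
rewrite -(subnKC tb) addSnnS.
have -> : init_state x p = state 0 (rmem (init_state x p), nmem (init_state x p)) by [].
by rewrite en add0n -(size_scode _ 0) run_end hm.
Qed.
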